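(* The following hold. (1) For any (standard) natural numbers $n,\ell\ge 1$, $$\mathsf{RCA}_0\vdash \mathsf{RT}^{n}_{<\infty,\ell}\rightarrow \Sigma^0_n\text{-}\mathsf{RT}^{1}_{<\infty,\ell}.$$ (2) For any (standard) natural numbers $n,\ell\ge 1$, $$\mathsf{RCA}_0\vdash \mathsf{RT}^{n}_{<\infty,\ell}\rightarrow \mathsf{B}\Sigma^0_{n+1}.$$
   Context: $\mathsf{RCA}_0$ is the usual base system of second-order arithmetic ($\Delta^0_1$-comprehension and $\Sigma^0_1$-induction). Formulas may contain number and set parameters. Finite sets of numbers are coded by natural numbers. $[\mathbb{N}]^n$ (resp. $[H]^n$) is the set of strictly increasing $n$-tuples from $\mathbb{N}$ (resp. $H$). $\mathsf{RT}^{n}_{<\infty,\ell}$: for every $k$ and every coloring $c\colon[\mathbb{N}]^n\to\{0,1,\dots,k-1\}$ there is an infinite set $H\subseteq\mathbb{N}$ such that $|c([H]^n)|\le\ell$. Total $\Sigma^0_n$-function: a $\Sigma^0_n$ formula $\varphi(x,y)$ with $\forall x\,\exists! y\,\varphi(x,y)$. For a given $k$, write $\varphi\colon\mathbb{N}\to\{0,1,\dots,k-1\}$ when $\forall x\,\exists! y<k\ \varphi(x,y)$. An $\ell$-homogeneous set for a total $\Sigma^0_n$-function $\varphi\colon\mathbb{N}\to\{0,\dots,k-1\}$ is an infinite set $H$ such that $$\exists s\subseteq\{0,1,\dots,k-1\}\,\bigl(|s|\le\ell\ \land\ \forall x\,\exists y\in H\,(x<y)\ \land\ \forall h\in H\,\exists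 i\in s\ \varphi(h,i)\bigr).$$ $\Sigma^0_n\text{-}\mathsf{RT}^{1}_{<\infty,\ell}$: for any $k$ and any total $\Sigma^0_n$-function $\varphi\colon\mathbb{N}\to\{0,1,\dots,k-1\}$, there exists an $\ell$-homogeneous set for $\varphi$ (as a set of the second-order universe). $\mathsf{B}\Sigma^0_{m}$ (the $\Sigma^0_m$-bounding principle): for every $\Sigma^0_m$ formula $\psi(x,y)$ and every $w$, if $\forall x<w\,\exists y\,\psi(x,y)$ then $\exists v\,\forall x<w\,\exists y<v\,\psi(x,y)$. *)

(* Defs.v *)
From Stdlib Require Import List Arith.
Import ListNotations.

Declare Scope so_scope.
Delimit Scope so_scope with so.

(** * The language of second-order arithmetic

  Number variables and set variables are two independent families of de Bruijn
  indices: [All] binds number variable 0, [AllS] binds set variable 0. *)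

Inductive term : Type :=
| Var (x : nat)
| Zero
| One
| Add (t s : term)
| Mul (t s : term).

Inductive form : Type :=
| Bot
| Eq (t s : term)
| Lt (t s : term)
| Mem (t : term) (X : nat)
| Imp (p q : form)
| All (p : form)
| AllS (p : form).

Declare Scope so_term_scope.
Delimit Scope so_term_scope with t.
Bind Scope so_term_scope with term.
Bind Scope so_scope with form.
Infix "+" := Add : so_term_scope.
Infix "*" := Mul : so_term_scope.
Notation "0" := Zero : so_term_scope.
Notation "1" := One : so_term_scope.

(** The logic is classical, so the remaining connectives are abbreviations. *)

Definition Neg (p : form) : form := Imp p Bot.
Definition Top : form := Neg Bot.
Definition Or (p q : form) : form := Imp (Neg p) q.
Definition And (p q : form) : form := Neg (Imp p (Neg q)).
Definition Iff (p q : form) : form := And (Imp p q) (Imp q p).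
Definition Ex (p : form) : form := Neg (All (Neg p)).
Definition ExS (p : form) : form := Neg (AllS (Neg p)).

Infix "≐" := Eq (at level 70, no associativity) : so_scope.
Infix "≺" := Lt (at level 70, no associativity) : so_scope.
Infix "∈" := Mem (at level 70, no associativity) : so_scope.
Infix "∧" := And (at level 80, right associativity) : so_scope.
Infix "∨" := Or (at level 85, right associativity) : so_scope.
Infix "⊃" := Imp (at level 90, right associativity) : so_scope.
Infix "⇔" := Iff (at level 92, no associativity) : so_scope.
Notation "¬ p" := (Neg p) (at level 75, right associativity) : so_scope.

Open Scope so_scope.

(** ** Substitution *)

Fixpoint tsubst (f : nat -> term) (t : term) : term :=
  match t with
  | Var x => f x
  | Zero => Zero
  | One => One
  | Add a b => Add (tsubst f a) (tsubst f b)
  | Mul a b => Mul (tsubst f a) (tsubst f b)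
  end.

Definition tlift (m : nat) : term -> term := tsubst (fun x => Var (m + x)).

Definition up (f : nat -> term) (x : nat) : term :=
  match x with 0 => Var 0 | S x' => tlift 1 (f x') end.

Definition upS (g : nat -> nat) (X : nat) : nat :=
  match X with 0 => 0 | S X' => S (g X') end.

(** Simultaneous substitution of terms for number variables and of set
  variables for set variables (the only terms of the set sort). *)
Fixpoint subst (f : nat -> term) (g : nat -> nat) (p : form) : form :=
  match p with
  | Bot => Bot
  | Eq t s => Eq (tsubst f t) (tsubst f s)
  | Lt t s => Lt (tsubst f t) (tsubst f s)
  | Mem t X => Mem (tsubst f t) (g X)
  | Imp p q => Imp (subst f g p) (subst f g q)
  | All p => All (subst (up f) g p)
  | AllS p => AllS (subst f (upS g) p)
  end.

Definition inst (t : term) : form -> form :=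
  subst (fun x => match x with 0 => t | S x' => Var x' end) (fun X => X).

Definition instS (Y : nat) : form -> form :=
  subst Var (fun X => match X with 0 => Y | S X' => X' end).

Definition liftS : form -> form := subst Var S.

(** [insert c m p] moves [p] below [m] extra number binders placed just outside
  its [c] innermost ones: indices below [c] stay, the others go up by [m]. *)
Definition insert (c m : nat) : form -> form :=
  subst (fun x => Var (if x <? c then x else m + x)) (fun X => X).

Definition lift : form -> form := insert 0 1.

(** ** Derived quantifiers and cardinality *)

Definition Alls (m : nat) (p : form) : form := Nat.iter m All p.
Definition Exs (m : nat) (p : form) : form := Nat.iter m Ex p.

(** In [BAll t p] and [BEx t p] the bound [t] lives outside the binder. *)
Definition BAll (t : term) (p : form) : form := All (Var 0 ≺ tlift 1 t ⊃ p).
Definition BEx (t : term) (p : form) : form := Ex (Var 0 ≺ tlift 1 t ∧ p).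

Definition ExUnique (p : form) : form :=
  Ex (p ∧ All (insert 1 1 p ⊃ Var 0 ≐ Var 1)).

Definition BExUnique (t : term) (p : form) : form :=
  ExUnique (Var 0 ≺ tlift 1 t ∧ p).

Definition BigOr (ps : list form) : form := fold_right Or Bot ps.

(** "The class of all [y] with [p(y)] has at most [l] elements", for a standard
  [l]; [y] is variable 0 of [p]. *)
Definition CardLe (l : nat) (p : form) : form :=
  Exs l (All (insert 1 l p ⊃
              BigOr (map (fun j => Var 0 ≐ Var (S j)) (seq 0 l)))).

(** * Provability

  Natural deduction for classical two-sorted first-order logic with equality
  on the number sort. Members of [T] are usable under any hypotheses, and
  [AllI], [AllSI] only shift the hypotheses; a member of [T] with free variables
  therefore has the strength of its universal closure. *)

Inductive prv (T : form -> Prop) : list form -> form -> Prop :=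
| Ax G p : T p -> prv T G p
| Hyp G p : In p G -> prv T G p
| ImpI G p q : prv T (p :: G) q -> prv T G (p ⊃ q)
| ImpE G p q : prv T G (p ⊃ q) -> prv T G p -> prv T G q
| Raa G p : prv T ((¬ p) :: G) Bot -> prv T G p
| AllI G p : prv T (map lift G) p -> prv T G (All p)
| AllE G p t : prv T G (All p) -> prv T G (inst t p)
| AllSI G p : prv T (map liftS G) p -> prv T G (AllS p)
| AllSE G p X : prv T G (AllS p) -> prv T G (instS X p)
| EqRefl G t : prv T G (t ≐ t)
| EqSubst G t s p : prv T G (t ≐ s) -> prv T G (inst t p) -> prv T G (inst s p).

Notation "T ⊢ p" := (prv T [] p) (at level 95, no associativity).

(** * The arithmetical hierarchy *)

Inductive Delta0 : form -> Prop :=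
| D0_Bot : Delta0 Bot
| D0_Eq t s : Delta0 (t ≐ s)
| D0_Lt t s : Delta0 (t ≺ s)
| D0_Mem t X : Delta0 (t ∈ X)
| D0_Imp p q : Delta0 p -> Delta0 q -> Delta0 (p ⊃ q)
| D0_BAll t p : Delta0 p -> Delta0 (BAll t p)
| D0_BEx t p : Delta0 p -> Delta0 (BEx t p).

Fixpoint Sigma (n : nat) (p : form) : Prop :=
  match n with
  | 0 => Delta0 p
  | S m => exists q, p = Ex q /\ Pi m q
  end
with Pi (n : nat) (p : form) : Prop :=
  match n with
  | 0 => Delta0 p
  | S m => exists q, p = All q /\ Sigma m q
  end.

(** * The system RCA0 *)

Definition succ0 (x : nat) : term :=
  match x with O => Var x + One | S _ => Var x end.

Inductive RCA0 : form -> Prop :=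
| ax_succ_neq0 :
    RCA0 (All (¬ (Var 0 + 1 ≐ 0)))
| ax_succ_inj :
    RCA0 (All (All (Var 1 + 1 ≐ Var 0 + 1 ⊃ Var 1 ≐ Var 0)))
| ax_add0 :
    RCA0 (All (Var 0 + 0 ≐ Var 0))
| ax_addS :
    RCA0 (All (All (Var 1 + (Var 0 + 1) ≐ (Var 1 + Var 0) + 1)))
| ax_mul0 :
    RCA0 (All (Var 0 * 0 ≐ 0))
| ax_mulS :
    RCA0 (All (All (Var 1 * (Var 0 + 1) ≐ Var 1 * Var 0 + Var 1)))
| ax_lt0 :
    RCA0 (All (¬ (Var 0 ≺ 0)))
| ax_ltS :
    RCA0 (All (All (Var 1 ≺ Var 0 + 1 ⇔ (Var 1 ≺ Var 0 ∨ Var 1 ≐ Var 0))))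
| ax_induction p : Sigma 1 p ->
    RCA0 (inst 0 p
          ∧ All (p ⊃ subst succ0 (fun X => X) p)
          ⊃ All p)
| ax_comprehension p q : Sigma 1 p -> Pi 1 q ->
    RCA0 (All (p ⇔ q) ⊃ ExS (All (Var 0 ∈ 0 ⇔ liftS p))).

(** * Coding in the language *)

Definition Pair (t s : term) : term := ((t + s) * (t + s) + t)%t.

(** [⟨x1, …, xn⟩ = ((x1, x2), …, xn)], and [⟨x⟩ = x]. *)
Definition Tuple (ts : list term) : term :=
  match ts with
  | [] => Zero
  | t :: ts' => fold_left Pair ts' t
  end.

Fixpoint Increasing (ts : list term) : form :=
  match ts with
  | t :: ((s :: _) as ts') => t ≺ s ∧ Increasing ts'
  | _ => Top
  end.

(** The list [x1, …, xn] of variables bound, in this order from the outside, by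
  [n] consecutive number quantifiers that have [a] further ones below them. *)
Definition vars (a n : nat) : list term := map Var (rev (seq a n)).

(** The number [s = (k, (m, n))] codes the finite set of all [i < k] such that
  [m (i + 1) + 1] divides [n]. No minimality is imposed on codes, so a finite
  set has several of them. *)
Definition FMem (i s : term) : form :=
  Ex (Ex (Ex (
    tlift 3 s ≐ Pair (Var 2) (Pair (Var 1) (Var 0))
    ∧ tlift 3 i ≺ Var 2
    ∧ Ex ((Var 2 * (tlift 4 i + 1) + 1) * Var 0 ≐ Var 1)))).

Infix "∈f" := FMem (at level 70, no associativity) : so_scope.

Definition Infinite (H : nat) : form :=
  All (Ex (Var 0 ∈ H ∧ Var 1 ≺ Var 0)).

(** * Ramsey's theorem *)

(** The set [C] is (the graph of) a function from [[N]^n] to [{0, …, k-1}]: it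
  is a subset of the product, and each tuple has exactly one value. *)
Definition Coloring (n : nat) (k : term) (C : nat) : form :=
  All (Var 0 ∈ C ⊃
       Exs n (Ex (Increasing (vars 1 n)
                  ∧ Var 0 ≺ tlift (n + 2) k
                  ∧ Var (n + 1) ≐ Pair (Tuple (vars 1 n)) (Var 0))))
  ∧ Alls n (Increasing (vars 0 n) ⊃
            ExUnique (Pair (Tuple (vars 1 n)) (Var 0) ∈ C)).

(** Variable 0 belongs to the image of [[H]^n] under [C]. *)
Definition Image (n C H : nat) : form :=
  Exs n (Increasing (vars 0 n)
         ∧ fold_right And Top (map (fun t => t ∈ H) (vars 0 n))
         ∧ Pair (Tuple (vars 0 n)) (Var n) ∈ C).

Definition RT (n l : nat) : form :=
  All (AllS (Coloring n (Var 0) 0 ⊃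
             ExS (Infinite 0 ∧ CardLe l (Image n 1 0)))).

(** * Schemes

  In an instance given by [p(x, y)], [x] is variable 1 and [y] is variable 0 of
  [p]; its other free variables, of both sorts, are the parameters. *)

(** "[p] is a total function into [{0, …, k-1}]" *)
Definition TotalInto (k : term) (p : form) : form :=
  All (ExUnique p) ∧ All (BExUnique (tlift 1 k) p).

(** "[H] is an [l]-homogeneous set for [p] with values in [{0, …, k-1}]" *)
Definition Homogeneous (l : nat) (k : term) (p : form) (H : nat) : form :=
  Infinite H
  ∧ Ex (All (Var 0 ∈f Var 1 ⊃ Var 0 ≺ tlift 2 k)
        ∧ CardLe l (Var 0 ∈f Var 1)
        ∧ All (Var 0 ∈ H ⊃ Ex (Var 0 ∈f Var 2 ∧ insert 2 1 p))).

Definition SigmaRT1_instance (l : nat) (p : form) : form :=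
  All (TotalInto (Var 0) (insert 2 1 p) ⊃
       ExS (Homogeneous l (Var 0) (liftS (insert 2 1 p)) 0)).

Definition SigmaRT1 (n l : nat) (s : form) : Prop :=
  exists p, Sigma n p /\ s = SigmaRT1_instance l p.

Definition B_instance (p : form) : form :=
  All (BAll (Var 0) (Ex (insert 2 1 p)) ⊃
       Ex (BAll (Var 1) (BEx (Var 1) (insert 2 2 p)))).

Definition BSigma (m : nat) (s : form) : Prop :=
  exists p, Sigma m p /\ s = B_instance p.

(** [T] proves the implication from the sentence [a] to the scheme [S]. *)
Definition proves_scheme (T : form -> Prop) (a : form) (S : form -> Prop) : Prop :=
  forall s, S s -> T ⊢ a ⊃ s.

(* Main.v *)
(** By completeness of the calculus (a Henkin construction), it suffices to argue
  inside an arbitrary, possibly nonstandard, model of RCA0 with a fixed assignment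
  of the free set variables.

  There, BΣ(n+1) yields the least number principle for Σ(n) and Π(n), hence the
  limit lemma: a total Σ(n+1) function [F] into [k] is the limit of a Σ(n) one,
  whose value at [(x, s)] is read off the least pair [(y, z) < s] that has not been
  refuted below [s] as a witness of [F x = y]. Iterating this under BΣ(n) turns a
  total Σ(n) function into a Δ(1) coloring of increasing [n]-tuples. A set on which
  the coloring takes at most [l] values is [l]-homogeneous for [F]: each value
  [F h] is the color of some tuple [h < s1 < s2 < ...] with all [si] large.

  BΣ(n+1) follows from the same statement by induction on [n]. If Π(n) bounding
  fails for [psi] below [w], then "[x < w] and [psi(x, y)] for no [y < v]" is a
  Σ(n) relation of [v] and [x], by BΣ(n), and it has a Σ(n) uniformization
  [v |-> x]. On an infinite set this function takes at most [l] values [x]; as [l]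
  is standard, their witnesses [y] have a common bound [b], which contradicts the
  choice of the value at any [v > b] of the set. *)

From Stdlib Require Import List Arith Lia Ring Cantor.
From Stdlib Require Import Classical ClassicalEpsilon.
From Stdlib Require Import FunctionalExtensionality PropExtensionality.
Require Import Defs.
Import ListNotations.

(** * Substitution *)

(** There is no circle between coloring and bounding, because the levels differ: iterating limits
    for a Σ(n) function costs BΣ(n), and the pigeonhole applied to the uniformized function returns
    BΣ(n+1). The chain starts at BΣ(1), which Σ(1) induction provides, and since [RT] for n+1 yields
    [RT] for n, a single hypothesis feeds all lower levels. Inside a model the work is done with
    predicates on environments instead of formulas: [SG] and [PG] record that a defining formula of
    the right shape exists, and the handling of variables becomes composition with maps of
    environments. The obstacle is that the hierarchy is literal (each level has exactly one leading
    quantifier) while the projections of the pairing are not terms. Hence the detour through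
    functions with a Δ(0) graph and a term bound: they may be substituted into Δ(0) predicates, and
    through them like quantifiers can be merged. *)

Definition scons {A : Type} (a : A) (e : nat -> A) (x : nat) : A :=
  match x with 0 => a | S x' => e x' end.
Infix ".:" := scons (at level 55, right associativity).

Lemma scons_tail {A} (e : nat -> A) : e 0 .: (fun x => e (S x)) = e.
Proof. extensionality x; destruct x; reflexivity. Qed.

Lemma tsubst_comp f g t : tsubst f (tsubst g t) = tsubst (fun x => tsubst f (g x)) t.
Proof. induction t; simpl; congruence. Qed.

Lemma tsubst_id t : tsubst Var t = t.
Proof. induction t; simpl; congruence. Qed.

Lemma tsubst_up_tlift f t : tsubst (up f) (tlift 1 t) = tlift 1 (tsubst f t).
Proof. unfold tlift; rewrite !tsubst_comp; reflexivity. Qed.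

Lemma up_comp f f' : (fun x => tsubst (up f) (up f' x)) = up (fun x => tsubst f (f' x)).
Proof. extensionality x; destruct x; simpl; auto using tsubst_up_tlift. Qed.

Lemma up_Var : up Var = Var.
Proof. extensionality x; destruct x; reflexivity. Qed.

Lemma upS_comp g g' : (fun x => upS g (upS g' x)) = upS (fun x => g (g' x)).
Proof. extensionality x; destruct x; reflexivity. Qed.

Lemma upS_id : upS (fun X => X) = fun X => X.
Proof. extensionality x; destruct x; reflexivity. Qed.

Lemma subst_comp p : forall f g f' g',
  subst f g (subst f' g' p) = subst (fun x => tsubst f (f' x)) (fun X => g (g' X)) p.
Proof.
  induction p; intros; simpl; rewrite ?tsubst_comp, ?IHp, ?IHp1, ?IHp2, ?up_comp, ?upS_comp;
    reflexivity.
Qed.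

Lemma subst_id p : subst Var (fun X => X) p = p.
Proof.
  induction p; simpl; rewrite ?tsubst_id, ?up_Var, ?upS_id; congruence.
Qed.

Lemma subst_inst f g t p :
  subst f g (inst t p) = inst (tsubst f t) (subst (up f) g p).
Proof.
  unfold inst; rewrite !subst_comp; f_equal; extensionality x; destruct x; simpl; auto.
  unfold tlift; rewrite tsubst_comp; simpl; symmetry; apply tsubst_id.
Qed.

Lemma subst_instS f g Y p :
  subst f g (instS Y p) = instS (g Y) (subst f (upS g) p).
Proof.
  unfold instS; rewrite !subst_comp; f_equal; extensionality x; [|destruct x; auto].
  symmetry; apply tsubst_id.
Qed.

Lemma subst_lift f g p : subst (up f) g (lift p) = lift (subst f g p).
Proof. unfold lift, insert; rewrite !subst_comp; reflexivity. Qed.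

Lemma subst_liftS f g p : subst f (upS g) (liftS p) = liftS (subst f g p).
Proof.
  unfold liftS; rewrite !subst_comp; f_equal; extensionality x.
  symmetry; apply tsubst_id.
Qed.

(** * Strict upper bounds for free variables *)

Fixpoint tbound (t : term) : nat :=
  match t with
  | Var x => S x
  | Zero | One => 0
  | Add a b | Mul a b => Nat.max (tbound a) (tbound b)
  end.

Fixpoint nbound (p : form) : nat :=
  match p with
  | Bot => 0
  | Eq t s | Lt t s => Nat.max (tbound t) (tbound s)
  | Mem t _ => tbound t
  | Imp p q => Nat.max (nbound p) (nbound q)
  | All p => pred (nbound p)
  | AllS p => nbound p
  end.

Fixpoint sbound (p : form) : nat :=
  match p with
  | Bot | Eq _ _ | Lt _ _ => 0
  | Mem _ X => S X
  | Imp p q => Nat.max (sbound p) (sbound q)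
  | All p => sbound p
  | AllS p => pred (sbound p)
  end.

Lemma tsubst_agree t f f' : (forall x, x < tbound t -> f x = f' x) -> tsubst f t = tsubst f' t.
Proof.
  induction t; simpl; intros H; auto; f_equal; (apply IHt1 || apply IHt2);
    intros; apply H; lia.
Qed.

Lemma subst_agree p : forall f f' g g',
  (forall x, x < nbound p -> f x = f' x) -> (forall X, X < sbound p -> g X = g' X) ->
  subst f g p = subst f' g' p.
Proof.
  induction p; simpl; intros f f' g g' Hf Hg; f_equal;
    try (apply tsubst_agree; intros; apply Hf; lia);
    try (apply Hg; lia); auto.
  - apply IHp1; intros; (apply Hf || apply Hg); lia.
  - apply IHp2; intros; (apply Hf || apply Hg); lia.
  - apply IHp; auto. intros [|x] Hx; simpl; auto. rewrite Hf; auto. lia.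
  - apply IHp; auto. intros [|x] Hx; simpl; auto. rewrite Hg; auto. lia.
Qed.

(** * Structures and satisfaction *)

Record structure := {
  dom :> Type;
  sets : Type;
  zero : dom;
  one : dom;
  add : dom -> dom -> dom;
  mul : dom -> dom -> dom;
  lt : dom -> dom -> Prop;
  mem : dom -> sets -> Prop
}.
Arguments zero {s}. Arguments one {s}. Arguments add {s}. Arguments mul {s}.
Arguments lt {s}. Arguments mem {s}.

Fixpoint ev {M : structure} (e : nat -> M) (t : term) : M :=
  match t with
  | Var x => e x
  | Zero => zero
  | One => one
  | Add a b => add (ev e a) (ev e b)
  | Mul a b => mul (ev e a) (ev e b)
  end.

Fixpoint sat {M : structure} (e : nat -> M) (r : nat -> sets M) (p : form) : Prop :=
  match p with
  | Bot => False
  | Eq t s => ev e t = ev e s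
  | Lt t s => lt (ev e t) (ev e s)
  | Mem t X => mem (ev e t) (r X)
  | Imp p q => sat e r p -> sat e r q
  | All p => forall d, sat (d .: e) r p
  | AllS p => forall D, sat e (D .: r) p
  end.

Section Sat.
Context {M : structure}.
Implicit Types (e : nat -> M) (r : nat -> sets M) (xs ys zs : list M).

Lemma ev_tsubst e f t : ev e (tsubst f t) = ev (fun x => ev e (f x)) t.
Proof. induction t; simpl; congruence. Qed.

Lemma ev_tlift1 d e t : ev (d .: e) (tlift 1 t) = ev e t.
Proof. unfold tlift; rewrite ev_tsubst; reflexivity. Qed.

Lemma sat_subst p : forall e r f g,
  sat e r (subst f g p) <-> sat (fun x => ev e (f x)) (fun X => r (g X)) p.
Proof.
  induction p; simpl; intros; rewrite ?ev_tsubst; try tauto.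
  - rewrite IHp1, IHp2; tauto.
  - enough (H : forall d, (fun x => ev (d .: e) (up f x)) = d .: (fun x => ev e (f x))).
    + split; intros Hp d; specialize (Hp d); rewrite IHp, H in *; auto.
    + intros; extensionality x; destruct x; simpl; auto using ev_tlift1.
  - enough (H : forall d, (fun X => (d .: r) (upS g X)) = d .: (fun X => r (g X))).
    + split; intros Hp d; specialize (Hp d); rewrite IHp, H in *; auto.
    + intros; extensionality x; destruct x; reflexivity.
Qed.

Lemma sat_and e r p q : sat e r (p ∧ q) <-> sat e r p /\ sat e r q.
Proof. simpl; tauto. Qed.

Lemma sat_or e r p q : sat e r (p ∨ q) <-> sat e r p \/ sat e r q.
Proof. simpl; tauto. Qed.

Lemma sat_iff e r p q : sat e r (p ⇔ q) <-> (sat e r p <-> sat e r q).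
Proof. simpl; tauto. Qed.

Lemma sat_ex e r p : sat e r (Ex p) <-> exists d, sat (d .: e) r p.
Proof.
  simpl; split.
  - intros H; apply NNPP; intros H'; apply H; intros d Hd; eauto.
  - intros [d Hd] H; exact (H d Hd).
Qed.

Lemma sat_exS e r p : sat e r (ExS p) <-> exists D, sat e (D .: r) p.
Proof.
  simpl; split.
  - intros H; apply NNPP; intros H'; apply H; intros d Hd; eauto.
  - intros [d Hd] H; exact (H d Hd).
Qed.

Lemma sat_BAll e r t p :
  sat e r (BAll t p) <-> forall x, lt x (ev e t) -> sat (x .: e) r p.
Proof. unfold BAll. cbn [sat ev scons]. setoid_rewrite ev_tlift1. reflexivity. Qed.

Lemma sat_BEx e r t p :
  sat e r (BEx t p) <-> exists x, lt x (ev e t) /\ sat (x .: e) r p.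
Proof.
  unfold BEx. rewrite sat_ex. setoid_rewrite sat_and. cbn [sat ev scons].
  setoid_rewrite ev_tlift1. reflexivity.
Qed.

(** * Blocks of quantifiers and environments extended by lists *)

Fixpoint eapp xs e : nat -> M :=
  match xs with [] => e | x :: xs => x .: eapp xs e end.

Lemma eapp_app xs ys e : eapp (xs ++ ys) e = eapp xs (eapp ys e).
Proof. induction xs; simpl; congruence. Qed.

Lemma eapp_plus xs e i : eapp xs e (length xs + i) = e i.
Proof. induction xs; simpl; auto. Qed.

Lemma eapp_agree xs e e' i : i < length xs -> eapp xs e i = eapp xs e' i.
Proof.
  revert i. induction xs; simpl; intros [|i] H; simpl; auto; [lia|lia|].
  apply IHxs. lia.
Qed.

Lemma eapp_seq xs zs e :
  map (eapp (xs ++ zs) e) (seq (length xs) (length zs)) = zs.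
Proof.
  revert xs. induction zs as [|z zs IH]; intros xs; simpl; auto.
  f_equal.
  - rewrite eapp_app, <- (Nat.add_0_r (length xs)), eapp_plus. reflexivity.
  - specialize (IH (xs ++ [z])). rewrite <- app_assoc, length_app, Nat.add_1_r in IH.
    exact IH.
Qed.

Lemma ev_vars xs zs e n : length zs = n ->
  map (ev (eapp (xs ++ zs) e)) (vars (length xs) n) = rev zs.
Proof.
  intros <-. unfold vars. rewrite map_map. simpl. now rewrite map_rev, eapp_seq.
Qed.

Lemma sat_insert xs ys e r p c m : length xs = c -> length ys = m ->
  sat (eapp xs (eapp ys e)) r (insert c m p) <-> sat (eapp xs e) r p.
Proof.
  intros <- <-. unfold insert. rewrite sat_subst.
  replace (fun x => _) with (eapp xs e); [reflexivity|].
  extensionality i. simpl. destruct (Nat.ltb_spec i (length xs)).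
  - now apply eapp_agree.
  - replace i with (length xs + (i - length xs)) by lia.
    replace (length ys + _) with (length xs + (length ys + (i - length xs))) by lia.
    now rewrite !eapp_plus.
Qed.

(** The outermost quantifier of the block has the highest index, so its value is the last entry of
    the list; hence lists are split from the right. *)
Lemma sat_Exs n p r : forall e,
  sat e r (Exs n p) <-> exists zs, length zs = n /\ sat (eapp zs e) r p.
Proof.
  induction n; intros e.
  - split; [intros H; exists []; auto|intros [[|] [H Hp]]; [exact Hp|discriminate]].
  - change (Exs (S n) p) with (Ex (Exs n p)). rewrite sat_ex. split.
    + intros [d Hd]. apply IHn in Hd as [zs [Hl H]]. exists (zs ++ [d]).
      rewrite length_app, Hl, Nat.add_1_r, eapp_app. auto.
    + intros [zs [Hl H]]. destruct zs as [|d zs _] using rev_ind; [discriminate|].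
      rewrite length_app, Nat.add_1_r in Hl. injection Hl as Hl. rewrite eapp_app in H.
      exists d. apply IHn. eauto.
Qed.

Lemma sat_Alls n p r : forall e,
  sat e r (Alls n p) <-> forall zs, length zs = n -> sat (eapp zs e) r p.
Proof.
  induction n; intros e.
  - split; [intros H [|] Hl; [exact H|discriminate]|intros H; exact (H [] eq_refl)].
  - change (Alls (S n) p) with (All (Alls n p)). split.
    + intros H zs Hl. destruct zs as [|d zs _] using rev_ind; [discriminate|].
      rewrite length_app, Nat.add_1_r in Hl. injection Hl as Hl. rewrite eapp_app.
      exact (proj1 (IHn _) (H d) zs Hl).
    + intros H d. apply IHn. intros zs Hl. specialize (H (zs ++ [d])).
      rewrite eapp_app in H. apply H. rewrite length_app, Hl. apply Nat.add_1_r.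
Qed.

Lemma sat_ExUnique e r p :
  sat e r (ExUnique p) <-> exists y, sat (y .: e) r p /\ forall y', sat (y' .: e) r p -> y' = y.
Proof.
  unfold ExUnique. rewrite sat_ex. setoid_rewrite sat_and.
  apply Morphisms_Prop.ex_iff_morphism. intros y. cbn [sat ev scons].
  enough (forall y', sat (y' .: y .: e) r (insert 1 1 p) <-> sat (y' .: e) r p) by firstorder.
  intros y'. now apply (sat_insert [y'] [y]).
Qed.

Lemma sat_BigOr e r ps : sat e r (BigOr ps) <-> exists p, In p ps /\ sat e r p.
Proof.
  induction ps as [|p ps IH]; simpl; [firstorder|].
  change (BigOr (p :: ps)) with (p ∨ BigOr ps). rewrite IH.
  split.
  - intros H. destruct (classic (sat e r p)) as [Hp|Hp]; [eauto|].
    destruct (H Hp) as [q [Hq Hs]]. eauto.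
  - intros [q [[<-|Hq] Hs]]; [tauto|eauto].
Qed.

Lemma sat_BigAnd e r ts X :
  sat e r (fold_right And Top (map (fun t => t ∈ X) ts)) <-> Forall (fun x => mem x (r X)) (map (ev e) ts).
Proof.
  induction ts as [|t ts IH]; [simpl; split; [constructor|auto]|].
  cbn [map fold_right]. rewrite sat_and, IH, Forall_cons_iff. reflexivity.
Qed.

Lemma sat_CardLe l e r p :
  sat e r (CardLe l p) <-> exists L, length L = l /\ forall y, sat (y .: e) r p -> In y L.
Proof.
  unfold CardLe. rewrite sat_Exs.
  assert (HA : forall L, length L = l -> forall y,
    sat (y .: eapp L e) r (insert 1 l p) <-> sat (y .: e) r p)
    by (intros; now apply (sat_insert [y] L)).
  assert (HB : forall L, length L = l -> forall y,
    sat (y .: eapp L e) r (BigOr (map (fun j => Var 0 ≐ Var (S j)) (seq 0 l))) <-> In y L).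
  { intros L Hl y. rewrite sat_BigOr.
    assert (HI : In y L <-> exists j, eapp L e j = y /\ In j (seq 0 l)).
    { rewrite <- in_map_iff, <- Hl. pose proof (eapp_seq [] L e) as HE.
      simpl in HE. now rewrite HE. }
    rewrite HI. split.
    - intros [q [Hq Hs]]. apply in_map_iff in Hq as [j [<- Hj]]. exists j. simpl in *. auto.
    - intros [j [Hy Hj]]. exists (Var 0 ≐ Var (S j)). split; [|simpl; auto].
      apply in_map_iff. eauto. }
  split; intros [L [Hl HL]]; exists L; (split; [exact Hl|]).
  - intros y Hy. apply HB; auto. apply (HL y). now apply HA.
  - intros y Hy. apply HB; auto. apply HL. now apply (HA L).
Qed.

End Sat.

(** * Completeness *)

Fixpoint term_code (t : term) : nat :=
  match t with
  | Var x => to_nat (0, x)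
  | Zero => to_nat (1, 0)
  | One => to_nat (2, 0)
  | Add a b => to_nat (3, to_nat (term_code a, term_code b))
  | Mul a b => to_nat (4, to_nat (term_code a, term_code b))
  end.

Fixpoint form_code (p : form) : nat :=
  match p with
  | Bot => to_nat (0, 0)
  | Eq t s => to_nat (1, to_nat (term_code t, term_code s))
  | Lt t s => to_nat (2, to_nat (term_code t, term_code s))
  | Mem t X => to_nat (3, to_nat (term_code t, X))
  | Imp p q => to_nat (4, to_nat (form_code p, form_code q))
  | All p => to_nat (5, form_code p)
  | AllS p => to_nat (6, form_code p)
  end.

Lemma to_nat_inj x y x' y' : to_nat (x, y) = to_nat (x', y') -> x = x' /\ y = y'.
Proof.
  intros H; apply (f_equal of_nat) in H; rewrite !cancel_of_to in H.
  inversion H; auto.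
Qed.

Ltac split_code :=
  repeat match goal with
  | H : to_nat _ = to_nat _ |- _ => apply to_nat_inj in H as [? ?]
  end.

Lemma term_code_inj t : forall s, term_code t = term_code s -> t = s.
Proof.
  induction t; intros []; cbn [term_code]; intros H; split_code; try discriminate;
    f_equal; auto.
Qed.

Lemma form_code_inj p : forall q, form_code p = form_code q -> p = q.
Proof.
  induction p; intros []; cbn [form_code]; intros H; split_code; try discriminate;
    f_equal; auto using term_code_inj.
Qed.

(** A left inverse of the coding; numbers that code nothing are sent to an arbitrary formula. *)
Definition nth_form (n : nat) : form := epsilon (inhabits Bot) (fun p => form_code p = n).

Lemma nth_form_code p : nth_form (form_code p) = p.
Proof.
  apply form_code_inj; unfold nth_form.
  apply (epsilon_spec (inhabits Bot) (fun q => form_code q = form_code p)); eauto.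
Qed.

Section Completeness.
Variable T : form -> Prop.
Hypothesis T_subst : forall f g p, T p -> T (subst f g p).

Lemma prv_weaken G p : prv T G p -> forall G', incl G G' -> prv T G' p.
Proof.
  induction 1; intros G' HG.
  - now apply Ax.
  - apply Hyp; auto.
  - apply ImpI, IHprv. intros x [->|Hx]; simpl; auto.
  - eapply ImpE; eauto.
  - apply Raa, IHprv. intros x [->|Hx]; simpl; auto.
  - apply AllI, IHprv. now apply incl_map.
  - apply AllE; auto.
  - apply AllSI, IHprv. now apply incl_map.
  - apply AllSE; auto.
  - apply EqRefl.
  - eapply EqSubst; eauto.
Qed.

(** Members of [T] may have free variables, which [AllI] does not shift; closure of [T] under
    substitution is what allows a variable to be renamed in a whole derivation. *)
Lemma prv_subst G p : prv T G p -> forall f g,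
  prv T (map (subst f g) G) (subst f g p).
Proof.
  induction 1; intros f g.
  - now apply Ax, T_subst.
  - apply Hyp. now apply in_map.
  - apply ImpI, IHprv.
  - eapply ImpE; [apply IHprv1 | apply IHprv2].
  - apply Raa, IHprv.
  - apply AllI. specialize (IHprv (up f) g). rewrite map_map in *.
    erewrite map_ext; [exact IHprv | intros; symmetry; apply subst_lift].
  - rewrite subst_inst. apply AllE, IHprv.
  - apply AllSI. specialize (IHprv f (upS g)). rewrite map_map in *.
    erewrite map_ext; [exact IHprv | intros; symmetry; apply subst_liftS].
  - rewrite subst_instS. apply AllSE, IHprv.
  - apply EqRefl.
  - rewrite subst_inst in *. eapply EqSubst; [apply IHprv1|].
    rewrite <- subst_inst. apply IHprv2.
Qed.

Lemma prv_explode G p : prv T G Bot -> prv T G p.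
Proof. intros H; apply Raa. eapply prv_weaken; eauto. now apply incl_tl. Qed.

(** Renaming [c] to 0 and every other [x] to [x + 1] acts as [lift] on the hypotheses, where [c]
    does not occur, and undoes the instantiation of [q]. This recovers the usual eigenvariable
    rule. *)
Lemma generalize_fresh G q c :
  (forall p, In p G -> nbound p <= c) -> nbound (All q) <= c ->
  prv T G (inst (Var c) q) -> prv T G (All q).
Proof.
  intros HG Hq H. apply AllI.
  apply (fun H => prv_subst _ _ H (fun x => if x =? c then Var 0 else Var (S x)) (fun X => X)) in H.
  replace (map lift G) with
    (map (subst (fun x => if x =? c then Var 0 else Var (S x)) (fun X => X)) G).
  - unfold inst in H; rewrite subst_comp in H.
    erewrite subst_agree, subst_id in H; [exact H| |reflexivity].
    intros [|x] Hx; simpl in *; [now rewrite Nat.eqb_refl|].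
    destruct (Nat.eqb_spec x c); auto; lia.
  - apply map_ext_in. intros p Hp; unfold lift, insert. apply subst_agree; auto.
    intros x Hx. specialize (HG p Hp). destruct (Nat.eqb_spec x c); auto; lia.
Qed.

Lemma generalizeS_fresh G q c :
  (forall p, In p G -> sbound p <= c) -> sbound (AllS q) <= c ->
  prv T G (instS c q) -> prv T G (AllS q).
Proof.
  intros HG Hq H. apply AllSI.
  apply (fun H => prv_subst _ _ H Var (fun x => if x =? c then 0 else S x)) in H.
  replace (map liftS G) with
    (map (subst Var (fun x => if x =? c then 0 else S x)) G).
  - unfold instS in H; rewrite subst_comp in H.
    erewrite subst_agree, subst_id in H; [exact H|reflexivity|].
    intros [|x] Hx; simpl in *; [now rewrite Nat.eqb_refl|].
    destruct (Nat.eqb_spec x c); auto; lia.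
  - apply map_ext_in. intros p Hp; unfold liftS. apply subst_agree; auto.
    intros x Hx. specialize (HG p Hp). destruct (Nat.eqb_spec x c); auto; lia.
Qed.

Definition consistent (G : list form) : Prop := ~ prv T G Bot.

Definition list_bound (b : form -> nat) (G : list form) : nat := list_max (map b G).

Lemma list_bound_in b G p : In p G -> b p <= list_bound b G.
Proof.
  intros H. unfold list_bound.
  pose proof (proj1 (list_max_le (map b G) _) (le_n _)) as HF.
  rewrite Forall_forall in HF. apply HF. now apply in_map.
Qed.

Definition witness (p : form) (G : list form) : list form :=
  match p with
  | Imp (All q) Bot => (¬ inst (Var (list_bound nbound G)) q) :: G
  | Imp (AllS q) Bot => (¬ instS (list_bound sbound G) q) :: G
  | _ => G
  end.

Lemma witness_incl p G : incl G (witness p G).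
Proof.
  intros x Hx. destruct p as [| | | |[] []| |]; simpl; auto.
Qed.

Lemma witness_consistent p G : consistent (p :: G) -> consistent (witness p (p :: G)).
Proof.
  intros HC. unfold consistent, witness in *.
  destruct p as [| | | |[| | | | |q|q] []| |]; auto; intros H; apply HC.
  - eapply ImpE; [apply Hyp; left; reflexivity|].
    apply generalize_fresh with (c := list_bound nbound ((¬ All q) :: G));
      [intros ? ?; now apply list_bound_in| |apply Raa, H].
    etransitivity; [|apply list_bound_in; left; reflexivity]. simpl; lia.
  - eapply ImpE; [apply Hyp; left; reflexivity|].
    apply generalizeS_fresh with (c := list_bound sbound ((¬ AllS q) :: G));
      [intros ? ?; now apply list_bound_in| |apply Raa, H].
    etransitivity; [|apply list_bound_in; left; reflexivity]. simpl; lia.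
Qed.

Section Henkin.
Variable G0 : list form.
Hypothesis G0_consistent : consistent G0.

Fixpoint stage (n : nat) : list form :=
  match n with
  | 0 => G0
  | S n' =>
      if excluded_middle_informative (consistent (nth_form n' :: stage n'))
      then witness (nth_form n') (nth_form n' :: stage n')
      else stage n'
  end.

Lemma stage_consistent n : consistent (stage n).
Proof.
  induction n; simpl; auto.
  destruct excluded_middle_informative; auto. now apply witness_consistent.
Qed.

Lemma stage_incl n m : n <= m -> incl (stage n) (stage m).
Proof.
  induction 1; [apply incl_refl|]. simpl.
  destruct excluded_middle_informative; auto.
  intros x Hx. apply witness_incl. right. auto.
Qed.

Definition holds (p : form) : Prop := exists n, prv T (stage n) p.

Lemma holds_imp p q : holds (p ⊃ q) -> holds p -> holds q.
Proof.
  intros [n H] [m H']. exists (n + m).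
  eapply ImpE; eapply prv_weaken; eauto; apply stage_incl; lia.
Qed.

Lemma holds_bot : ~ holds Bot.
Proof. intros [n H]. exact (stage_consistent n H). Qed.

(** Maximality: each formula is tested at the stage given by its code, where it is either added or
    refuted. *)
Lemma holds_neg p : holds (¬ p) <-> ~ holds p.
Proof.
  split.
  - intros H H'. apply holds_bot. eapply holds_imp; eauto.
  - intros H. exists (S (form_code p)). simpl. rewrite nth_form_code.
    destruct excluded_middle_informative as [HC|HC].
    + exfalso. apply H. exists (S (form_code p)). simpl. rewrite nth_form_code.
      destruct excluded_middle_informative; [|tauto].
      apply Hyp, witness_incl. now left.
    + apply ImpI. now apply NNPP.
Qed.

Lemma holds_impI p q : (holds p -> holds q) -> holds (p ⊃ q).
Proof.
  intros H. destruct (classic (holds p)) as [Hp|Hp].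
  - destruct (H Hp) as [n Hn]. exists n. apply ImpI. eapply prv_weaken; eauto. now apply incl_tl.
  - apply holds_neg in Hp as [n Hn]. exists n. apply ImpI, prv_explode.
    eapply ImpE; [eapply prv_weaken; [exact Hn|now apply incl_tl]|apply Hyp; now left].
Qed.

(** A formula that holds is consistent with the stage at which it is tested, so it was added there
    together with its witness. *)
Lemma holds_witness p : holds p -> exists n, incl (witness p (p :: stage n)) (stage (S n)) .
Proof.
  intros [n Hn]. exists (form_code p). simpl. rewrite nth_form_code.
  destruct excluded_middle_informative as [HC|HC]; [apply incl_refl|].
  exfalso. apply HC. intros HB. apply holds_bot.
  apply holds_imp with p; [|exists n; exact Hn]. exists (form_code p). now apply ImpI.
Qed.

Lemma holds_all q : holds (All q) <-> forall t, holds (inst t q).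
Proof.
  split.
  - intros [n H] t. exists n. now apply AllE.
  - intros H. apply NNPP. intros HN. apply holds_neg in HN.
    destruct (holds_witness _ HN) as [n Hn]. simpl in Hn.
    apply holds_bot. eapply holds_imp; [|apply H].
    exists (S n). apply Hyp, Hn. now left.
Qed.

Lemma holds_allS q : holds (AllS q) <-> forall X, holds (instS X q).
Proof.
  split.
  - intros [n H] t. exists n. now apply AllSE.
  - intros H. apply NNPP. intros HN. apply holds_neg in HN.
    destruct (holds_witness _ HN) as [n Hn]. simpl in Hn.
    apply holds_bot. eapply holds_imp; [|apply H].
    exists (S n). apply Hyp, Hn. now left.
Qed.

(** * The term model *)

Definition teq (t s : term) : Prop := holds (t ≐ s).

Lemma holds_replace t s p : teq t s -> holds (inst t p) -> holds (inst s p).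
Proof.
  intros [n H] [m H']. exists (n + m).
  eapply EqSubst; eapply prv_weaken; eauto; apply stage_incl; lia.
Qed.

Lemma teq_refl t : teq t t.
Proof. exists 0. apply EqRefl. Qed.

Lemma inst_shift t (u : term) : tsubst (fun x => match x with 0 => t | S x' => Var x' end) (tlift 1 u) = u.
Proof. unfold tlift; rewrite tsubst_comp; apply tsubst_id. Qed.

Lemma teq_replace (F : term -> form) p : (forall u, F u = inst u p) ->
  forall t s, teq t s -> holds (F t) -> holds (F s).
Proof. intros HF t s H. rewrite !HF. now apply holds_replace. Qed.

Lemma teq_sym t s : teq t s -> teq s t.
Proof.
  intros H. apply (teq_replace (fun u => u ≐ t) (Var 0 ≐ tlift 1 t)) with t;
    [|exact H|apply teq_refl].
  intros u. unfold inst; simpl. now rewrite inst_shift.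
Qed.

Lemma teq_trans t s u : teq t s -> teq s u -> teq t u.
Proof.
  intros H H'. apply (teq_replace (fun u => t ≐ u) (tlift 1 t ≐ Var 0)) with s;
    [|exact H'|exact H].
  intros v. unfold inst; simpl. now rewrite inst_shift.
Qed.

(** Provably equal terms have extensionally equal predicates [teq t], so [epsilon] picks the same
    representative for them. The quotient is thus a type of representatives with ordinary
    equality. *)
Definition norm (t : term) : term := epsilon (inhabits Zero) (teq t).

Lemma norm_teq t : teq t (norm t).
Proof. apply (epsilon_spec (inhabits Zero) (teq t)). exists t. apply teq_refl. Qed.

Lemma teq_norm t s : teq t s -> norm t = norm s.
Proof.
  intros H. unfold norm. f_equal. extensionality u. apply propositional_extensionality.
  split; intros; eauto using teq_sym, teq_trans.
Qed.

Definition tclass : Type := {t : term | norm t = t}.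

Definition cls (t : term) : tclass :=
  exist _ (norm t) (teq_norm _ _ (teq_sym _ _ (norm_teq t))).

Definition rep (c : tclass) : term := proj1_sig c.

Lemma cls_eq t s : cls t = cls s <-> teq t s.
Proof.
  split.
  - intros H. apply (f_equal rep) in H. simpl in H.
    eapply teq_trans; [apply norm_teq|]. rewrite H. apply teq_sym, norm_teq.
  - intros H. apply eq_sig_hprop; [intros; apply proof_irrelevance|].
    simpl. now apply teq_norm.
Qed.

Lemma rep_cls t : teq t (rep (cls t)).
Proof. apply norm_teq. Qed.

Lemma cls_rep c : cls (rep c) = c.
Proof.
  destruct c as [t H]. apply eq_sig_hprop; [intros; apply proof_irrelevance|]. exact H.
Qed.

(** Only the number sort carries equality, so set variables can denote themselves without a
    quotient. *)
Definition term_model : structure := {|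
  dom := tclass;
  sets := nat;
  zero := cls Zero;
  one := cls One;
  add a b := cls (Add (rep a) (rep b));
  mul a b := cls (Mul (rep a) (rep b));
  lt a b := holds (rep a ≺ rep b);
  mem a X := holds (rep a ∈ X)
|}.

Lemma teq_cong (F : term -> term) : (exists u, forall t, F t = tsubst (t .: Var) u) ->
  forall t s, teq t s -> teq (F t) (F s).
Proof.
  intros [u Hu] t s H.
  apply (teq_replace (fun v => F t ≐ F v) (tlift 1 (F t) ≐ u)) with t;
    [|exact H|apply teq_refl].
  intros v. unfold inst; simpl. rewrite inst_shift, (Hu v). reflexivity.
Qed.

Lemma teq_cong2 (C : term -> term -> term) :
  (forall f a b, tsubst f (C a b) = C (tsubst f a) (tsubst f b)) ->
  forall a b a' b', teq a a' -> teq b b' -> teq (C a b) (C a' b').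
Proof.
  intros HC a b a' b' Ha Hb. apply teq_trans with (C a' b).
  - apply (teq_cong (fun t => C t b)); auto. exists (C (Var 0) (tlift 1 b)).
    intros t. rewrite HC. f_equal. symmetry; apply inst_shift.
  - apply (teq_cong (fun t => C a' t)); auto. exists (C (tlift 1 a') (Var 0)).
    intros t. rewrite HC. f_equal. symmetry; apply inst_shift.
Qed.

Lemma ev_term_model f t : @ev term_model (fun x => cls (f x)) t = cls (tsubst f t).
Proof.
  induction t; simpl; auto.
  - rewrite IHt1, IHt2. apply cls_eq. apply (teq_cong2 Add); auto using teq_sym, rep_cls.
  - rewrite IHt1, IHt2. apply cls_eq. apply (teq_cong2 Mul); auto using teq_sym, rep_cls.
Qed.

Lemma holds_lt_cong a b a' b' : teq a a' -> teq b b' -> holds (a ≺ b) -> holds (a' ≺ b').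
Proof.
  intros Ha Hb H.
  apply (teq_replace (fun v => a' ≺ v) (tlift 1 a' ≺ Var 0)) with b; [|exact Hb|].
  - intros v. unfold inst; simpl. now rewrite inst_shift.
  - apply (teq_replace (fun v => v ≺ b) (Var 0 ≺ tlift 1 b)) with a; [|exact Ha|exact H].
    intros v. unfold inst; simpl. now rewrite inst_shift.
Qed.

Lemma holds_mem_cong a a' X : teq a a' -> holds (a ∈ X) -> holds (a' ∈ X).
Proof.
  apply (teq_replace (fun v => v ∈ X) (Var 0 ∈ X)). reflexivity.
Qed.

Lemma inst_up f g t q : inst t (subst (up f) g q) = subst (t .: f) g q.
Proof.
  unfold inst; rewrite subst_comp; f_equal. extensionality x. destruct x; simpl; auto using inst_shift.
Qed.

Lemma instS_upS f g X q : instS X (subst f (upS g) q) = subst f (X .: g) q.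
Proof.
  unfold instS; rewrite subst_comp; f_equal; extensionality x; [apply tsubst_id|].
  destruct x; reflexivity.
Qed.

(** Arbitrary substitutions are allowed because, under a quantifier, an element of the model turns
    into a term substituted for the bound variable. *)
Lemma truth p : forall f g,
  @sat term_model (fun x => cls (f x)) g p <-> holds (subst f g p).
Proof.
  induction p; intros f g; simpl.
  - split; [tauto|apply holds_bot].
  - rewrite !ev_term_model. apply cls_eq.
  - rewrite !ev_term_model. split; apply holds_lt_cong; auto using teq_sym, rep_cls.
  - rewrite !ev_term_model. split; apply holds_mem_cong; auto using teq_sym, rep_cls.
  - rewrite IHp1, IHp2. split; [apply holds_impI | intros; eapply holds_imp; eauto].
  - rewrite holds_all.
    assert (HE : forall t, (cls t .: (fun x => cls (f x))) = fun x => cls ((t .: f) x)).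
    { intros d. extensionality x. destruct x; reflexivity. }
    split; intros H.
    + intros t. rewrite inst_up. apply IHp. rewrite <- HE. apply H.
    + intros d. rewrite <- (cls_rep d), HE. apply IHp. rewrite <- inst_up. apply H.
  - rewrite holds_allS.
    split; intros H X; specialize (H X); [|apply IHp]; rewrite ?instS_upS in *; auto.
    now apply IHp.
Qed.

End Henkin.

Theorem completeness p :
  (forall M : structure, (forall q, T q -> forall (e : nat -> M) r, sat e r q) ->
     forall (e : nat -> M) r, sat e r p) ->
  prv T [] p.
Proof.
  intros H. apply NNPP. intros HN.
  assert (HC : consistent [¬ p]) by (intros HB; now apply HN, Raa).
  assert (Hp : holds [¬ p] (¬ p)) by (exists 0; apply Hyp; now left).
  apply (holds_neg _ HC) in Hp. apply Hp.
  enough (Hs : holds [¬ p] (subst Var (fun X => X) p)) by now rewrite subst_id in Hs.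
  apply (truth _ HC), H.
  intros q Hq e r.
  replace e with (fun x => cls [¬ p] (rep [¬ p] (e x))) by (extensionality x; apply cls_rep).
  apply (truth _ HC). exists 0. now apply Ax, T_subst.
Qed.

End Completeness.

(** * Axioms of RCA0 under substitution *)

Lemma Delta0_subst p : Delta0 p -> forall f g, Delta0 (subst f g p).
Proof.
  induction 1; intros f g; try (simpl; constructor; auto; fail).
  - unfold BAll; simpl. rewrite tsubst_up_tlift. apply D0_BAll, IHDelta0.
  - unfold BEx, Ex, And, Neg; simpl. rewrite tsubst_up_tlift. apply D0_BEx, IHDelta0.
Qed.

Lemma SigmaPi_subst n : forall p,
  (Sigma n p -> forall f g, Sigma n (subst f g p)) /\
  (Pi n p -> forall f g, Pi n (subst f g p)).
Proof.
  induction n; simpl; intros p; [split; apply Delta0_subst|].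
  split; intros [q [-> Hq]] f g; (eexists; split; [reflexivity|]); now apply IHn.
Qed.

Lemma RCA0_subst f g p : RCA0 p -> RCA0 (subst f g p).
Proof.
  intros H. destruct H as [| | | | | | | |p Hp|p q Hp Hq]; try (simpl; constructor; fail).
  - pose proof (ax_induction _ (proj1 (SigmaPi_subst 1 p) Hp (up f) g)) as H.
    unfold And, Neg in *. simpl. rewrite subst_inst.
    replace (subst (up f) g (subst succ0 (fun X => X) p)) with
      (subst succ0 (fun X => X) (subst (up f) g p)); [exact H|].
    rewrite !subst_comp. f_equal.
    extensionality x. destruct x; simpl; auto.
    unfold tlift. rewrite tsubst_comp. reflexivity.
  - pose proof (ax_comprehension _ _ (proj1 (SigmaPi_subst 1 p) Hp (up f) g)
      (proj2 (SigmaPi_subst 1 q) Hq (up f) g)) as H.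
    unfold ExS, Iff, And, Neg in *. simpl. now rewrite subst_liftS.
Qed.

(** One assignment is fixed for the set parameters. Sets obtained later from comprehension or Ramsey
    are inspected from outside and never become parameters of a definable predicate, so it never has
    to change. *)
Class rca0_model (M : structure) := {
  model_axioms : forall p, RCA0 p -> forall (e : nat -> M) r, sat e r p;
  assignment : nat -> sets M
}.

(** * Arithmetic in a model of RCA0 *)

Section Model.
Context {M : structure} {HM : rca0_model M}.
Local Notation r := assignment.
Local Notation env := (nat -> M).
Local Notation "0" := (@zero M).
Local Notation "1" := (@one M).
Local Infix "+" := (@add M).
Local Infix "*" := (@mul M).
Local Infix "<" := (@lt M).
Implicit Types e : env.

Lemma induction_Sigma1 p e : Sigma 1 p ->
  sat (0 .: e) r p -> (forall d, sat (d .: e) r p -> sat (d + 1 .: e) r p) ->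
  forall d, sat (d .: e) r p.
Proof.
  intros Hp H0 HS d. pose proof (model_axioms _ (ax_induction p Hp) e r) as H.
  change (sat e r (inst 0%t p ∧ All (p ⊃ subst succ0 (fun X => X) p)) -> sat e r (All p)) in H.
  rewrite sat_and in H.
  assert (HE : forall d, (fun x => ev (d .: e) (succ0 x)) = (d + 1 .: e))
    by (intros; extensionality i; destruct i; reflexivity).
  apply H. split.
  - unfold inst. rewrite sat_subst.
    replace (fun x => _) with (0 .: e); [exact H0|extensionality i; destruct i; reflexivity].
  - intros a Ha. rewrite sat_subst, HE. auto.
Qed.

(** [Sigma 1] demands a literal leading [Ex]; a vacuous one is put in front. *)
Lemma induction_Delta0 p e : Delta0 p ->
  sat (0 .: e) r p -> (forall d, sat (d .: e) r p -> sat (d + 1 .: e) r p) ->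
  forall d, sat (d .: e) r p.
Proof.
  intros Hp H0 HS d.
  assert (HL : forall d, sat (d .: e) r (Ex (lift p)) <-> sat (d .: e) r p).
  { intros a. rewrite sat_ex. unfold lift, insert. setoid_rewrite sat_subst.
    split; [intros [? H]|intros H; exists 0]; exact H. }
  apply HL, induction_Sigma1.
  - exists (lift p). split; auto. now apply Delta0_subst.
  - now apply HL.
  - intros a Ha. apply HL, HS, HL, Ha.
Qed.

Let z0 : env := fun _ => 0.

Lemma succ_neq0 x : x + 1 <> 0.
Proof. exact (model_axioms _ ax_succ_neq0 z0 r x). Qed.

Lemma succ_inj x y : x + 1 = y + 1 -> x = y.
Proof. exact (model_axioms _ ax_succ_inj z0 r x y). Qed.

Lemma add_0_r x : x + 0 = x.
Proof. exact (model_axioms _ ax_add0 z0 r x). Qed.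

Lemma add_S_r x y : x + (y + 1) = (x + y) + 1.
Proof. exact (model_axioms _ ax_addS z0 r x y). Qed.

Lemma mul_0_r x : x * 0 = 0.
Proof. exact (model_axioms _ ax_mul0 z0 r x). Qed.

Lemma mul_S_r x y : x * (y + 1) = x * y + x.
Proof. exact (model_axioms _ ax_mulS z0 r x y). Qed.

Lemma nlt_0 x : ~ x < 0.
Proof. exact (model_axioms _ ax_lt0 z0 r x). Qed.

Lemma lt_S x y : x < y + 1 <-> x < y \/ x = y.
Proof.
  pose proof (model_axioms _ ax_ltS z0 r x y) as H.
  rewrite sat_iff, sat_or in H. exact H.
Qed.

Lemma add_0_l x : 0 + x = x.
Proof.
  apply (induction_Delta0 (0 + Var 0 ≐ Var 0) z0); simpl; [constructor|apply add_0_r|].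
  intros d H. rewrite add_S_r. congruence.
Qed.

Lemma add_S_l x y : (x + 1) + y = (x + y) + 1.
Proof.
  apply (induction_Delta0 ((Var 1 + 1) + Var 0 ≐ (Var 1 + Var 0) + 1) (x .: z0)); simpl;
    [constructor|now rewrite !add_0_r|].
  intros d H. rewrite !add_S_r. congruence.
Qed.

Lemma add_comm x y : x + y = y + x.
Proof.
  apply (induction_Delta0 (Var 1 + Var 0 ≐ Var 0 + Var 1) (x .: z0)); simpl;
    [constructor|now rewrite add_0_r, add_0_l|].
  intros d H. rewrite add_S_r, add_S_l. congruence.
Qed.

Lemma add_assoc x y z : x + (y + z) = (x + y) + z.
Proof.
  apply (induction_Delta0 (Var 1 + (Var 2 + Var 0) ≐ (Var 1 + Var 2) + Var 0) (x .: y .: z0));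
    simpl; [constructor|now rewrite !add_0_r|].
  intros d H. rewrite !add_S_r. congruence.
Qed.

Lemma mul_0_l x : 0 * x = 0.
Proof.
  apply (induction_Delta0 (0 * Var 0 ≐ 0) z0); simpl; [constructor|apply mul_0_r|].
  intros d H. now rewrite mul_S_r, add_0_r.
Qed.

Lemma mul_S_l x y : (x + 1) * y = x * y + y.
Proof.
  apply (induction_Delta0 ((Var 1 + 1) * Var 0 ≐ Var 1 * Var 0 + Var 0) (x .: z0)); simpl;
    [constructor|now rewrite !mul_0_r, add_0_r|].
  intros d H. rewrite !mul_S_r, H, !add_S_r. f_equal.
  rewrite <- !add_assoc. f_equal. apply add_comm.
Qed.

Lemma mul_comm x y : x * y = y * x.
Proof.
  apply (induction_Delta0 (Var 1 * Var 0 ≐ Var 0 * Var 1) (x .: z0)); simpl;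
    [constructor|now rewrite mul_0_r, mul_0_l|].
  intros d H. rewrite mul_S_r, mul_S_l. congruence.
Qed.

Lemma mul_add_l x y z : (x + y) * z = x * z + y * z.
Proof.
  apply (induction_Delta0 ((Var 1 + Var 2) * Var 0 ≐ Var 1 * Var 0 + Var 2 * Var 0) (x .: y .: z0));
    simpl; [constructor|now rewrite !mul_0_r, add_0_r|].
  intros d H. rewrite !mul_S_r, H, <- !add_assoc. f_equal.
  rewrite (add_comm x (_ + _)), <- !add_assoc. f_equal. apply add_comm.
Qed.

Lemma mul_assoc x y z : x * (y * z) = (x * y) * z.
Proof.
  apply (induction_Delta0 (Var 1 * (Var 2 * Var 0) ≐ (Var 1 * Var 2) * Var 0) (x .: y .: z0));
    simpl; [constructor|now rewrite !mul_0_r|].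
  intros d H. rewrite !mul_S_r, <- H, (mul_comm x (_ + _)), mul_add_l.
  now rewrite (mul_comm x y), (mul_comm x (_ * _)).
Qed.

Lemma mul_1_l x : 1 * x = x.
Proof.
  rewrite <- (add_0_l 1), mul_S_l, mul_0_l. apply add_0_l.
Qed.

Lemma semiring : semi_ring_theory 0 1 (@add M) (@mul M) eq.
Proof.
  constructor; auto using add_0_l, add_comm, add_assoc, mul_1_l, mul_0_l, mul_comm,
    mul_assoc, mul_add_l.
Qed.
Add Ring Mring : semiring.

Lemma add_cancel_r x y z : x + z = y + z -> x = y.
Proof.
  apply (induction_Delta0 (Var 1 + Var 0 ≐ Var 2 + Var 0 ⊃ Var 1 ≐ Var 2) (x .: y .: z0));
    simpl; [repeat constructor|now rewrite !add_0_r|].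
  intros d H Hd. rewrite !add_S_r in Hd. auto using succ_inj.
Qed.

Lemma add_cancel_l x y z : z + x = z + y -> x = y.
Proof. rewrite !(add_comm z). apply add_cancel_r. Qed.

Lemma zero_or_succ x : x = 0 \/ exists y, x = y + 1.
Proof.
  (* The quantifier is pulled in front of the disjunction to obtain a literal Σ(1) formula. *)
  pose proof (induction_Sigma1 (Ex (Var 1 ≐ 0 ∨ Var 1 ≐ Var 0 + 1)) z0) as H.
  setoid_rewrite sat_ex in H. setoid_rewrite sat_or in H. simpl in H.
  enough (HE : exists y, x = 0 \/ x = y + 1) by (destruct HE as [y [Hy|Hy]]; eauto).
  apply H.
  - eexists; split; [reflexivity|]. repeat constructor.
  - exists 0. auto.
  - intros d _. exists d. auto.
Qed.

Lemma add_eq_0 x y : x + y = 0 -> x = 0 /\ y = 0.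
Proof.
  destruct (zero_or_succ y) as [->|[z ->]].
  - rewrite add_0_r. auto.
  - rewrite add_S_r. intros H. now apply succ_neq0 in H.
Qed.

(** * Order *)

Definition le x y : Prop := exists z, x + z = y.
Local Infix "<=" := le.

(** The bridge from the axioms of the primitive order to addition: most later order laws amount to
    exhibiting a difference, which [ring] checks. *)
Lemma lt_le x y : x < y <-> x + 1 <= y.
Proof.
  split.
  - pose proof (induction_Sigma1 (Ex (Var 2 ≺ Var 1 ⊃ (Var 2 + 1) + Var 0 ≐ Var 1)) (x .: z0)) as H.
    setoid_rewrite sat_ex in H. simpl in H.
    intros Hxy. enough (HE : exists z, x < y -> x + 1 + z = y) by (destruct HE as [z Hz]; exists z; auto).
    apply H.
    + eexists; split; [reflexivity|]. repeat constructor.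
    + exists 0. intros H'. now apply nlt_0 in H'.
    + intros d [z Hz]. destruct (classic (x < d)) as [Hd|Hd].
      * exists (z + 1). intros _. rewrite add_S_r. now rewrite Hz.
      * exists 0. intros H'. apply lt_S in H' as [H'|<-]; [tauto|ring].
  - intros [z <-].
    apply (induction_Delta0 (Var 1 ≺ (Var 1 + 1) + Var 0) (x .: z0)); simpl; [constructor| |].
    + rewrite add_0_r. apply lt_S. auto.
    + intros d H. rewrite add_S_r. apply lt_S. auto.
Qed.

Lemma le_refl x : x <= x.
Proof. exists 0. apply add_0_r. Qed.

Lemma le_trans x y z : x <= y -> y <= z -> x <= z.
Proof. intros [u <-] [v <-]. exists (u + v). ring. Qed.

Lemma le_0 x : 0 <= x.
Proof. exists x. ring. Qed.

Lemma le_add_r x y : x <= x + y.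
Proof. now exists y. Qed.

Lemma le_add_l x y : x <= y + x.
Proof. exists y. ring. Qed.

Lemma add_le x y x' y' : x <= x' -> y <= y' -> x + y <= x' + y'.
Proof. intros [u <-] [v <-]. exists (u + v). ring. Qed.

Lemma mul_le x y x' y' : x <= x' -> y <= y' -> x * y <= x' * y'.
Proof. intros [u <-] [v <-]. exists (u * y + x * v + u * v). ring. Qed.

Lemma lt_irrefl x : ~ x < x.
Proof.
  rewrite lt_le. intros [u H]. apply (succ_neq0 u), (add_cancel_l _ _ x). rewrite add_0_r. rewrite <- H at 2. ring.
Qed.

Lemma lt_S_le x y : x < y + 1 <-> x <= y.
Proof.
  rewrite lt_le. split; intros [u H].
  - exists u. apply succ_inj. rewrite <- H. ring.
  - exists u. rewrite <- H. ring.
Qed.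

Lemma lt_S_diag x : x < x + 1.
Proof. apply lt_S_le, le_refl. Qed.

Lemma lt_incl_le x y : x < y -> x <= y.
Proof. intros H. apply lt_S_le, lt_S. auto. Qed.

Lemma lt_le_trans x y z : x < y -> y <= z -> x < z.
Proof. rewrite !lt_le. apply le_trans. Qed.

Lemma le_lt_trans x y z : x <= y -> y < z -> x < z.
Proof. rewrite !lt_le. intros H. apply le_trans. apply add_le; auto using le_refl. Qed.

Lemma lt_trans x y z : x < y -> y < z -> x < z.
Proof. intros H H'. eauto using lt_le_trans, lt_incl_le. Qed.

Lemma trichotomy x y : x < y \/ x = y \/ y < x.
Proof.
  pose proof (induction_Delta0 (Var 1 ≺ Var 0 ∨ (Var 1 ≐ Var 0 ∨ Var 0 ≺ Var 1)) (x .: z0)) as H.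
  setoid_rewrite sat_or in H. setoid_rewrite sat_or in H. simpl in H. apply H.
  - repeat constructor.
  - destruct (zero_or_succ x) as [->|[u ->]]; auto. right; right. apply lt_S_le, le_0.
  - intros d [Hd|[->|Hd]].
    + left. apply lt_S. auto.
    + left. apply lt_S_diag.
    + right. apply lt_le in Hd as [u <-]. destruct (zero_or_succ u) as [->|[v ->]].
      * left. ring.
      * right. apply lt_le. exists v. ring.
Qed.

Lemma not_lt x y : ~ x < y -> y <= x.
Proof.
  destruct (trichotomy x y) as [H|[->|H]]; [tauto|auto using le_refl|auto using lt_incl_le].
Qed.

(** * Pairing and its projections *)

Definition pair x y : M := (x + y) * (x + y) + x.

Lemma le_square x : x <= x * x.
Proof.
  destruct (zero_or_succ x) as [->|[y ->]]; [apply le_0|].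
  exists (y * y + y). ring.
Qed.

Lemma pair_le_l x y : x <= pair x y.
Proof. apply le_add_l. Qed.

Lemma pair_le_r x y : y <= pair x y.
Proof.
  unfold pair. eapply le_trans; [apply (le_add_l y x)|].
  eapply le_trans; [apply le_square|apply le_add_r].
Qed.

(** A code lies between the squares of [x + y] and [x + y + 1], so the sum of the components can be
    read off it. *)
Lemma pair_lt_sum x y x' y' : x + y < x' + y' -> pair x y < pair x' y'.
Proof.
  rewrite !lt_le. unfold pair. intros [u H].
  rewrite <- H. exists (x + y + y + u * u + u * (x + y + 1 + (x + y + 1)) + x'). ring.
Qed.

Lemma pair_inj x y x' y' : pair x y = pair x' y' -> x = x' /\ y = y'.
Proof.
  intros H. assert (HS : x + y = x' + y').
  { destruct (trichotomy (x + y) (x' + y')) as [HL|[HL|HL]]; auto;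
      apply pair_lt_sum in HL; rewrite H in HL; now apply lt_irrefl in HL. }
  unfold pair in H. rewrite HS in H. apply add_cancel_l in H as ->.
  split; auto. eapply add_cancel_l; eauto.
Qed.

Definition is_pair z : Prop := exists x y, z = pair x y.

(** The pairing is not onto. The value 0 off its range makes the projections total and bounded by
    their argument, as [DF] requires. *)
Definition pi1 z : M :=
  epsilon (inhabits 0) (fun x => (exists y, z = pair x y) \/ ~ is_pair z /\ x = 0).
Definition pi2 z : M :=
  epsilon (inhabits 0) (fun x => (exists y, z = pair y x) \/ ~ is_pair z /\ x = 0).

Lemma pi1_spec z x : x = pi1 z <-> (exists y, z = pair x y) \/ ~ is_pair z /\ x = 0.
Proof.
  assert (H : (exists y, z = pair (pi1 z) y) \/ ~ is_pair z /\ pi1 z = 0).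
  { unfold pi1. apply (epsilon_spec (inhabits 0) (fun x => (exists y, z = pair x y) \/ ~ is_pair z /\ x = 0)).
    destruct (classic (is_pair z)) as [[x' [y' H]]|H]; [exists x'; left; eauto|exists 0; auto]. }
  split; [intros ->; exact H|].
  intros [[y Hy]|[HN Hy]]; destruct H as [[y' H]|[HN' H]].
  - exact (proj1 (pair_inj _ _ _ _ (eq_trans (eq_sym Hy) H))).
  - destruct HN'. unfold is_pair. eauto.
  - destruct HN. unfold is_pair. eauto.
  - congruence.
Qed.

Lemma pi2_spec z x : x = pi2 z <-> (exists y, z = pair y x) \/ ~ is_pair z /\ x = 0.
Proof.
  assert (H : (exists y, z = pair y (pi2 z)) \/ ~ is_pair z /\ pi2 z = 0).
  { unfold pi2. apply (epsilon_spec (inhabits 0) (fun x => (exists y, z = pair y x) \/ ~ is_pair z /\ x = 0)).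
    destruct (classic (is_pair z)) as [[x' [y' H]]|H]; [exists y'; left; eauto|exists 0; auto]. }
  split; [intros ->; exact H|].
  intros [[y Hy]|[HN Hy]]; destruct H as [[y' H]|[HN' H]].
  - exact (proj2 (pair_inj _ _ _ _ (eq_trans (eq_sym Hy) H))).
  - destruct HN'. unfold is_pair. eauto.
  - destruct HN. unfold is_pair. eauto.
  - congruence.
Qed.

Lemma pi1_pair x y : pi1 (pair x y) = x.
Proof. symmetry. apply pi1_spec. left. eauto. Qed.

Lemma pi2_pair x y : pi2 (pair x y) = y.
Proof. symmetry. apply pi2_spec. left. eauto. Qed.

Lemma pi1_le z : pi1 z <= z.
Proof.
  destruct (proj1 (pi1_spec z _) eq_refl) as [[y Hy]|[_ ->]]; [|apply le_0].
  rewrite Hy at 2. apply pair_le_l.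
Qed.

Lemma pi2_le z : pi2 z <= z.
Proof.
  destruct (proj1 (pi2_spec z _) eq_refl) as [[y Hy]|[_ ->]]; [|apply le_0].
  rewrite Hy at 2. apply pair_le_r.
Qed.

(** * Definable predicates *)

Implicit Types (P Q : env -> Prop) (R : M -> env -> Prop) (f g : env -> M).

(** Membership is semantic, so a predicate can be exchanged for an equivalent one regardless of the
    shape of its formula. *)
Definition D0 P : Prop := exists p, Delta0 p /\ forall e, sat e r p <-> P e.

Lemma D0_ext P Q : (forall e, P e <-> Q e) -> D0 P -> D0 Q.
Proof. intros H [p [Hp HP]]. exists p. split; auto. intros e. now rewrite HP. Qed.

Lemma D0_subst s P : D0 P -> D0 (fun e => P (fun i => ev e (s i))).
Proof.
  intros [p [Hp HP]]. exists (subst s (fun X => X) p). split; [now apply Delta0_subst|].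
  intros e. rewrite sat_subst. apply HP.
Qed.

Lemma D0_imp P Q : D0 P -> D0 Q -> D0 (fun e => P e -> Q e).
Proof.
  intros [p [Hp HP]] [q [Hq HQ]]. exists (p ⊃ q). split; [now constructor|].
  intros e. simpl. now rewrite HP, HQ.
Qed.

Lemma D0_False : D0 (fun e => False).
Proof. exists Bot. split; [constructor|reflexivity]. Qed.

Lemma D0_not P : D0 P -> D0 (fun e => ~ P e).
Proof. intros H. exact (D0_imp _ _ H D0_False). Qed.

Lemma D0_and P Q : D0 P -> D0 Q -> D0 (fun e => P e /\ Q e).
Proof.
  intros HP HQ. eapply D0_ext; [|exact (D0_not _ (D0_imp _ _ HP (D0_not _ HQ)))].
  intros e. simpl. tauto.
Qed.

Lemma D0_or P Q : D0 P -> D0 Q -> D0 (fun e => P e \/ Q e).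
Proof.
  intros HP HQ. eapply D0_ext; [|exact (D0_imp _ _ (D0_not _ HP) HQ)].
  intros e. simpl. tauto.
Qed.

Lemma D0_bex_term t R : D0 (fun e => R (e O) (fun i => e (S i))) ->
  D0 (fun e => exists x, x < ev e t /\ R x e).
Proof.
  intros [p [Hp HP]]. exists (BEx t p). split; [now constructor|].
  intros e. unfold BEx. rewrite sat_ex. setoid_rewrite sat_and.
  apply Morphisms_Prop.ex_iff_morphism. intros x. rewrite (HP (x .: e)).
  simpl. now rewrite ev_tlift1.
Qed.

(** The term bound is what makes these functions substitutable into [D0] predicates. *)
Definition DF f : Prop := exists t G, D0 G /\ (forall e, f e <= ev e t) /\
  forall e y, G (y .: e) <-> y = f e.

Lemma D0_subst_fun f R : DF f -> D0 (fun e => R (e O) (fun i => e (S i))) ->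
  D0 (fun e => R (f e) e).
Proof.
  intros [t [G [HG [Hb HF]]]] HR.
  apply D0_ext with (fun e => exists y, y < ev e (Add t One) /\ (G (y .: e) /\ R y e)).
  - intros e; split.
    + intros [y [_ [Hy HRy]]]. apply HF in Hy as ->. exact HRy.
    + intros H. exists (f e). repeat split; auto; [apply lt_S_le, Hb|now apply HF].
  - apply D0_bex_term, D0_and; auto.
    apply (D0_ext G); auto. intros e. now rewrite scons_tail.
Qed.

Lemma DF_subst s f : DF f -> DF (fun e => f (fun i => ev e (s i))).
Proof.
  intros [t [G [HG [Hb HF]]]].
  exists (tsubst s t), (fun e => G (fun i => ev e (up s i))). repeat split.
  - now apply D0_subst.
  - intros e. rewrite ev_tsubst. apply Hb.
  - intros H. apply HF. replace (y .: _) with (fun i => ev (y .: e) (up s i)); auto.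
    extensionality i. destruct i; simpl; auto using ev_tlift1.
  - intros H. apply HF in H. replace (y .: _) with (fun i => ev (y .: e) (up s i)) in H; auto.
    extensionality i. destruct i; simpl; auto using ev_tlift1.
Qed.

Lemma DF_rename (ρ : nat -> nat) f : DF f -> DF (fun e => f (fun i => e (ρ i))).
Proof. apply (DF_subst (fun i => Var (ρ i))). Qed.

Lemma D0_rename (ρ : nat -> nat) P : D0 P -> D0 (fun e => P (fun i => e (ρ i))).
Proof. apply (D0_subst (fun i => Var (ρ i))). Qed.

Lemma DF_term t : DF (fun e => ev e t).
Proof.
  exists t, (fun e => e O = ev (fun i => e (S i)) t). repeat split; auto using le_refl.
  exists (Var 0 ≐ tlift 1 t). split; [constructor|].
  intros e. simpl. unfold tlift. now rewrite ev_tsubst.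
Qed.

Lemma D0_eq f g : DF f -> DF g -> D0 (fun e => f e = g e).
Proof.
  intros Hf Hg. apply (D0_subst_fun f (fun x e => x = g e)); auto.
  apply (D0_subst_fun (fun e => g (fun i => e (S i))) (fun y e => e O = y)); auto using DF_rename.
  exists (Var 1 ≐ Var 0). split; [constructor|reflexivity].
Qed.

Lemma D0_lt f g : DF f -> DF g -> D0 (fun e => f e < g e).
Proof.
  intros Hf Hg. apply (D0_subst_fun f (fun x e => x < g e)); auto.
  apply (D0_subst_fun (fun e => g (fun i => e (S i))) (fun y e => e O < y)); auto using DF_rename.
  exists (Var 1 ≺ Var 0). split; [constructor|reflexivity].
Qed.

Lemma D0_mem f X : DF f -> D0 (fun e => mem (f e) (r X)).
Proof.
  intros Hf. apply (D0_subst_fun f (fun x e => mem x (r X))); auto.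
  exists (Var 0 ∈ X). split; [constructor|reflexivity].
Qed.

Lemma D0_bex f R : DF f -> D0 (fun e => R (e O) (fun i => e (S i))) ->
  D0 (fun e => exists x, x < f e /\ R x e).
Proof.
  intros Hf HR. apply (D0_subst_fun f (fun b e => exists x, x < b /\ R x e)); auto.
  apply (D0_bex_term (Var 0) (fun x e => R x (fun i => e (S i)))).
  exact (D0_rename (fun i => match i with O => O | S i => S (S i) end) _ HR).
Qed.

Lemma D0_ball f R : DF f -> D0 (fun e => R (e O) (fun i => e (S i))) ->
  D0 (fun e => forall x, x < f e -> R x e).
Proof.
  intros Hf HR. eapply D0_ext; [|exact (D0_not _ (D0_bex f (fun x e => ~ R x e) Hf (D0_not _ HR)))].
  intros e. simpl. split.
  - intros H x Hx. apply NNPP. eauto.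
  - intros H [x [Hx HN]]. auto.
Qed.

Lemma DF_var n : DF (fun e => e n).
Proof. exact (DF_term (Var n)). Qed.

Lemma DF_0 : DF (fun e => 0).
Proof. exact (DF_term Zero). Qed.

Lemma DF_1 : DF (fun e => 1).
Proof. exact (DF_term One). Qed.

Lemma DF_add f g : DF f -> DF g -> DF (fun e => f e + g e).
Proof.
  intros Hf Hg. pose proof Hf as [t [_ [_ [Ht _]]]]. pose proof Hg as [s [_ [_ [Hs _]]]].
  exists (Add t s), (fun e => e O = f (fun i => e (S i)) + g (fun i => e (S i))).
  repeat split; auto; [|intros; now apply add_le].
  apply (D0_subst_fun (fun e => f (fun i => e (S i)))
    (fun x e => e O = x + g (fun i => e (S i)))); auto using DF_rename.
  apply (D0_subst_fun (fun e => g (fun i => e (S (S i)))) (fun x e => e (S O) = e O + x));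
    [now apply (DF_rename (fun i => S (S i)))|].
  exists (Var 2 ≐ Var 1 + Var 0)%t. split; [constructor|reflexivity].
Qed.

Lemma DF_mul f g : DF f -> DF g -> DF (fun e => f e * g e).
Proof.
  intros Hf Hg. pose proof Hf as [t [_ [_ [Ht _]]]]. pose proof Hg as [s [_ [_ [Hs _]]]].
  exists (Mul t s), (fun e => e O = f (fun i => e (S i)) * g (fun i => e (S i))).
  repeat split; auto; [|intros; now apply mul_le].
  apply (D0_subst_fun (fun e => f (fun i => e (S i)))
    (fun x e => e O = x * g (fun i => e (S i)))); auto using DF_rename.
  apply (D0_subst_fun (fun e => g (fun i => e (S (S i)))) (fun x e => e (S O) = e O * x));
    [now apply (DF_rename (fun i => S (S i)))|].
  exists (Var 2 ≐ Var 1 * Var 0)%t. split; [constructor|reflexivity].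
Qed.

Lemma DF_pair f g : DF f -> DF g -> DF (fun e => pair (f e) (g e)).
Proof. intros Hf Hg. unfold pair. auto using DF_add, DF_mul. Qed.

Lemma bounded_graph f h : DF h -> (forall e, f e <= h e) ->
  D0 (fun e => e O = f (fun i => e (S i))) -> DF f.
Proof.
  intros [t [_ [_ [Ht _]]]] Hb HG.
  exists t, (fun e => e O = f (fun i => e (S i))). repeat split; eauto using le_trans.
Qed.

Lemma is_pair_bounded z : is_pair z <->
  exists x, x < z + 1 /\ exists y, y < z + 1 /\ z = pair x y.
Proof.
  unfold is_pair. split; [|intros [x [_ [y [_ H]]]]; eauto].
  intros [x [y ->]]. exists x. split; [apply lt_S_le, pair_le_l|].
  exists y. split; [apply lt_S_le, pair_le_r|auto].
Qed.

Lemma DF_pi1 f : DF f -> DF (fun e => pi1 (f e)).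
Proof.
  intros Hf. apply bounded_graph with f; auto using pi1_le.
  apply (D0_subst_fun (fun e => f (fun i => e (S i))) (fun z e => e O = pi1 z));
    auto using DF_rename.
  apply D0_ext with (fun e => (exists y, y < e O + 1 /\ e O = pair (e (S O)) y) \/
    ~ (exists x, x < e O + 1 /\ exists y, y < e O + 1 /\ e O = pair x y) /\ e (S O) = 0).
  - intros e. cbn beta. rewrite pi1_spec, <- is_pair_bounded. split; intros [H|H]; auto; left.
    + destruct H as [y [_ H]]. eauto.
    + destruct H as [y H]. exists y. split; auto. rewrite H. apply lt_S_le, pair_le_r.
  - repeat first [apply D0_or | apply D0_and | apply D0_not | apply D0_bex | apply D0_eq
      | apply DF_var | apply DF_pair | apply DF_add | apply DF_0 | apply DF_1].
Qed.

Lemma DF_pi2 f : DF f -> DF (fun e => pi2 (f e)).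
Proof.
  intros Hf. apply bounded_graph with f; auto using pi2_le.
  apply (D0_subst_fun (fun e => f (fun i => e (S i))) (fun z e => e O = pi2 z));
    auto using DF_rename.
  apply D0_ext with (fun e => (exists y, y < e O + 1 /\ e O = pair y (e (S O))) \/
    ~ (exists x, x < e O + 1 /\ exists y, y < e O + 1 /\ e O = pair x y) /\ e (S O) = 0).
  - intros e. cbn beta. rewrite pi2_spec, <- is_pair_bounded. split; intros [H|H]; auto; left.
    + destruct H as [y [_ H]]. eauto.
    + destruct H as [y H]. exists y. split; auto. rewrite H. apply lt_S_le, pair_le_l.
  - repeat first [apply D0_or | apply D0_and | apply D0_not | apply D0_bex | apply D0_eq
      | apply DF_var | apply DF_pair | apply DF_add | apply DF_0 | apply DF_1].
Qed.

(** Rearranging variables, unpacking a pair and adding an argument are all maps of environments of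
    this kind, so one composition lemma per class of predicates covers them. *)
Definition Good (F : env -> env) : Prop := forall i, DF (fun e => F e i).

Lemma Good_rename (ρ : nat -> nat) : Good (fun e i => e (ρ i)).
Proof. intros i. apply DF_var. Qed.

Lemma Good_cons f F : DF f -> Good F -> Good (fun e => f e .: F e).
Proof. intros Hf HF [|i]; simpl; auto. Qed.

Lemma Good_shift F : Good F -> Good (fun e => F (fun i => e (S i))).
Proof. intros HF i. apply (DF_rename S (fun e => F e i)), HF. Qed.

Lemma Good_up F : Good F -> Good (fun e => e O .: F (fun i => e (S i))).
Proof. intros HF. apply Good_cons; auto using Good_shift, DF_var. Qed.

Lemma DF_ev F t : Good F -> DF (fun e => ev (F e) t).
Proof. intros HF. induction t; simpl; auto using DF_0, DF_1, DF_add, DF_mul. Qed.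

(** After composition the bounds of quantifiers are no longer terms. The induction on the formula
    therefore relies on closure under quantifiers bounded by [DF] functions. *)
Lemma D0_comp F P : Good F -> D0 P -> D0 (fun e => P (F e)).
Proof.
  intros HF [p [Hp HP]]. apply D0_ext with (fun e => sat (F e) r p); auto. clear P HP.
  revert F HF. induction Hp; intros F HF.
  - apply D0_False.
  - apply D0_eq; now apply DF_ev.
  - apply D0_lt; now apply DF_ev.
  - apply D0_mem; now apply DF_ev.
  - apply D0_imp; auto.
  - apply D0_ext with (fun e => forall x, x < ev (F e) t -> sat (x .: F e) r p).
    + intros e. unfold BAll. cbn [sat ev scons]. setoid_rewrite ev_tlift1. reflexivity.
    + apply (D0_ball (fun e => ev (F e) t) (fun x e => sat (x .: F e) r p)); [now apply DF_ev|].
      exact (IHHp _ (Good_up _ HF)).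
  - apply D0_ext with (fun e => exists x, x < ev (F e) t /\ sat (x .: F e) r p).
    + intros e. unfold BEx. rewrite sat_ex. setoid_rewrite sat_and. cbn [sat ev scons]. setoid_rewrite ev_tlift1. reflexivity.
    + apply (D0_bex (fun e => ev (F e) t) (fun x e => sat (x .: F e) r p)); [now apply DF_ev|].
      exact (IHHp _ (Good_up _ HF)).
Qed.

(** Semantic counterparts of [Sigma] and [Pi]; set parameters enter through [assignment]. *)
Fixpoint SG n P : Prop :=
  match n with
  | O => D0 P
  | S m => exists Q, PG m Q /\ forall e, P e <-> exists x, Q (x .: e)
  end
with PG n P : Prop :=
  match n with
  | O => D0 P
  | S m => exists Q, SG m Q /\ forall e, P e <-> forall x, Q (x .: e)
  end.

Lemma PG_ext n P Q : (forall e, P e <-> Q e) -> PG n P -> PG n Q.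
Proof.
  intros H HP. replace Q with P; auto. extensionality e. now apply propositional_extensionality.
Qed.

Lemma SPG_comp n : forall F P, Good F ->
  (SG n P -> SG n (fun e => P (F e))) /\ (PG n P -> PG n (fun e => P (F e))).
Proof.
  induction n; intros F P HF; [split; now apply D0_comp|].
  split; intros [Q [HQ HP]]; (exists (fun e => Q (e O .: F (fun i => e (S i)))));
    (split; [now apply (IHn _ Q (Good_up _ HF))|]); intros e; apply HP.
Qed.

Lemma SG_comp n F P : Good F -> SG n P -> SG n (fun e => P (F e)).
Proof. intros HF. now apply SPG_comp. Qed.

Lemma PG_comp n F P : Good F -> PG n P -> PG n (fun e => P (F e)).
Proof. intros HF. now apply SPG_comp. Qed.

Lemma SPG_not n : forall P,
  (SG n P -> PG n (fun e => ~ P e)) /\ (PG n P -> SG n (fun e => ~ P e)).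
Proof.
  induction n; intros P; [split; apply D0_not|].
  split; intros [Q [HQ HP]]; (exists (fun e => ~ Q e)); (split; [now apply IHn|]);
    intros e; rewrite HP.
  - firstorder.
  - split; [apply not_all_ex_not|firstorder].
Qed.

Lemma SG_not n P : PG n P -> SG n (fun e => ~ P e).
Proof. apply SPG_not. Qed.

Lemma PG_not n P : SG n P -> PG n (fun e => ~ P e).
Proof. apply SPG_not. Qed.

Lemma SG_PG n P : SG n P -> PG (S n) P.
Proof.
  intros H. exists (fun e => P (fun i => e (S i))). split; [apply SG_comp; auto using Good_rename|].
  intros e. split; [auto|intros HP; exact (HP 0)].
Qed.

Lemma PG_SG n P : PG n P -> SG (S n) P.
Proof.
  intros H. exists (fun e => P (fun i => e (S i))). split; [apply PG_comp; auto using Good_rename|].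
  intros e. split; [intros HP; exists 0; exact HP|intros [? HP]; exact HP].
Qed.

Lemma SPG_S n : forall P, (SG n P -> SG (S n) P) /\ (PG n P -> PG (S n) P).
Proof.
  induction n; intros P; [split; [apply (PG_SG 0)|apply (SG_PG 0)]|].
  split; intros [Q [HQ HP]]; exists Q; split; auto; now apply IHn.
Qed.

Lemma SG_S n P : SG n P -> SG (S n) P.
Proof. apply SPG_S. Qed.

Lemma PG_S n P : PG n P -> PG (S n) P.
Proof. apply SPG_S. Qed.

Lemma D0_SPG n : forall P, D0 P -> SG n P /\ PG n P.
Proof. induction n; intros P HP; [auto|]. split; [apply SG_S|apply PG_S]; now apply IHn. Qed.

Lemma D0_SG n P : D0 P -> SG n P.
Proof. apply D0_SPG. Qed.

Lemma D0_PG n P : D0 P -> PG n P.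
Proof. apply D0_SPG. Qed.

Ltac df := repeat first [apply DF_var | apply DF_pair | apply DF_add | apply DF_mul
  | apply DF_0 | apply DF_1 | apply DF_pi1 | apply DF_pi2 | assumption].
Ltac good := repeat first [apply Good_cons | apply Good_rename | progress df].

(** Existential quantifiers under a conjunction and universal ones under a disjunction are merged by
    pairing; in the other two cases the quantifier distributes. *)
Lemma SPG_and_or n : forall P Q,
  (SG n P -> SG n Q -> SG n (fun e => P e /\ Q e) /\ SG n (fun e => P e \/ Q e)) /\
  (PG n P -> PG n Q -> PG n (fun e => P e /\ Q e) /\ PG n (fun e => P e \/ Q e)).
Proof.
  induction n; intros P Q; [split; intros; split; now (apply D0_and || apply D0_or)|].
  assert (H1 : Good (fun e => pi1 (e O) .: (fun i => e (S i)))) by good.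
  assert (H2 : Good (fun e => pi2 (e O) .: (fun i => e (S i)))) by good.
  split; intros [P' [HP' HP]] [Q' [HQ' HQ]]; split.
  - exists (fun e => P' (pi1 (e O) .: (fun i => e (S i))) /\ Q' (pi2 (e O) .: (fun i => e (S i)))).
    split; [apply IHn; [exact (PG_comp n _ _ H1 HP')|exact (PG_comp n _ _ H2 HQ')]|].
    intros e. rewrite HP, HQ. split.
    + intros [[x Hx] [y Hy]]. exists (pair x y). simpl. now rewrite pi1_pair, pi2_pair.
    + intros [z [Hx Hy]]. eauto.
  - exists (fun e => P' e \/ Q' e). split; [now apply IHn|].
    intros e. rewrite HP, HQ. firstorder.
  - exists (fun e => P' e /\ Q' e). split; [now apply IHn|].
    intros e. rewrite HP, HQ. firstorder.
  - exists (fun e => P' (pi1 (e O) .: (fun i => e (S i))) \/ Q' (pi2 (e O) .: (fun i => e (S i)))).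
    split; [apply IHn; [exact (SG_comp n _ _ H1 HP')|exact (SG_comp n _ _ H2 HQ')]|].
    intros e. rewrite HP, HQ. split.
    + intros [H|H] z; simpl; auto.
    + intros H. apply NNPP. intros HN. apply not_or_and in HN as [Hx Hy].
      apply not_all_ex_not in Hx as [x Hx]. apply not_all_ex_not in Hy as [y Hy].
      specialize (H (pair x y)). simpl in H. rewrite pi1_pair, pi2_pair in H. tauto.
Qed.

Lemma SG_and n P Q : SG n P -> SG n Q -> SG n (fun e => P e /\ Q e).
Proof. intros; now apply SPG_and_or. Qed.

Lemma SG_or n P Q : SG n P -> SG n Q -> SG n (fun e => P e \/ Q e).
Proof. intros; now apply SPG_and_or. Qed.

Lemma PG_and n P Q : PG n P -> PG n Q -> PG n (fun e => P e /\ Q e).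
Proof. intros; now apply SPG_and_or. Qed.

Lemma PG_or n P Q : PG n P -> PG n Q -> PG n (fun e => P e \/ Q e).
Proof. intros; now apply SPG_and_or. Qed.

Lemma PG_imp n P Q : SG n P -> PG n Q -> PG n (fun e => P e -> Q e).
Proof.
  intros HP HQ. eapply PG_ext; [|exact (PG_or _ _ _ (PG_not _ _ HP) HQ)]. intros e. simpl. tauto.
Qed.

Lemma SG_ex n R : SG (S n) (fun e => R (e O) (fun i => e (S i))) ->
  SG (S n) (fun e => exists x, R x e).
Proof.
  intros [Q [HQ HR]]. exists (fun e => Q (pi2 (e O) .: pi1 (e O) .: (fun i => e (S i)))). split.
  - apply (PG_comp n (fun e => pi2 (e O) .: pi1 (e O) .: (fun i => e (S i)))); auto. good.
  - intros e. split.
    + intros [x Hx]. apply (HR (x .: e)) in Hx as [y Hy].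
      exists (pair x y). simpl. now rewrite pi1_pair, pi2_pair.
    + intros [z Hz]. exists (pi1 z). apply (HR (pi1 z .: e)). eauto.
Qed.

Lemma PG_all n R : PG (S n) (fun e => R (e O) (fun i => e (S i))) ->
  PG (S n) (fun e => forall x, R x e).
Proof.
  intros H. eapply PG_ext; [|apply PG_not, (SG_ex n (fun x e => ~ R x e)), SG_not, H].
  intros e. simpl. split; [|firstorder].
  intros HN x. apply NNPP. eauto.
Qed.

Lemma SG_bex n f R : DF f -> SG n (fun e => R (e O) (fun i => e (S i))) ->
  SG n (fun e => exists x, x < f e /\ R x e).
Proof.
  intros Hf HR. destruct n; [now apply D0_bex|].
  apply (SG_ex n (fun x e => x < f e /\ R x e)), SG_and; auto.
  apply D0_SG, D0_lt; auto using DF_var, DF_rename.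
Qed.

Lemma PG_ball n f R : DF f -> PG n (fun e => R (e O) (fun i => e (S i))) ->
  PG n (fun e => forall x, x < f e -> R x e).
Proof.
  intros Hf HR. destruct n; [now apply D0_ball|].
  apply (PG_all n (fun x e => x < f e -> R x e)), PG_imp; auto.
  apply D0_SG, D0_lt; auto using DF_var, DF_rename.
Qed.

(** * Collection and least number principles *)

(** [BΣ(n)]. *)
Definition Bnd n : Prop := forall P, SG n P -> forall e w,
  (forall x, x < w -> exists y, P (y .: x .: e)) ->
  exists v, forall x, x < w -> exists y, y < v /\ P (y .: x .: e).

Lemma Bnd_pred n : Bnd (S n) -> Bnd n.
Proof. intros H P HP. apply H, SG_S, HP. Qed.

(** The dual closure is a hypothesis here, so that this step is available inside the induction that
    proves [SG_ball]. *)
Lemma PG_bex_of n :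
  (forall f R, DF f -> SG n (fun e => R (e O) (fun i => e (S i))) ->
    SG n (fun e => forall x, x < f e -> R x e)) ->
  forall f R, DF f -> PG n (fun e => R (e O) (fun i => e (S i))) ->
  PG n (fun e => exists x, x < f e /\ R x e).
Proof.
  intros H f R Hf HR. eapply PG_ext; [|apply PG_not, (H f (fun x e => ~ R x e) Hf), SG_not, HR].
  intros e. simpl. split; [|firstorder].
  intros HN. apply NNPP. intros HE. apply HN. eauto.
Qed.

(** Collection trades the witness [y] depending on [x] for one common bound [v] in front. What
    remains is a bounded existential quantifier over a Π(n) predicate, which the induction
    hypothesis absorbs in its dual form. *)
Lemma SG_ball n : Bnd n -> forall f R, DF f -> SG n (fun e => R (e O) (fun i => e (S i))) ->
  SG n (fun e => forall x, x < f e -> R x e).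
Proof.
  induction n; intros HB f R Hf HR; [now apply D0_ball|].
  destruct HR as [Q [HQ HR]].
  exists (fun e => forall x, x < f (fun i => e (S i)) ->
    exists y, y < e O /\ Q (y .: x .: (fun i => e (S i)))). split.
  - apply (PG_ball n (fun e => f (fun i => e (S i)))
      (fun x e => exists y, y < e O /\ Q (y .: x .: (fun i => e (S i))))); auto using DF_rename.
    apply (PG_bex_of n (IHn (Bnd_pred _ HB)) (fun e => e (S O))
      (fun y e => Q (y .: e O .: (fun i => e (S (S i)))))); auto using DF_var.
    apply (PG_comp n (fun e => e O .: e (S O) .: (fun i => e (S (S (S i)))))); auto. good.
  - intros e. split.
    + intros H. apply (HB Q (PG_SG _ _ HQ) e (f e)).
      intros x Hx. apply (HR (x .: e)), H, Hx.
    + intros [v Hv] x Hx. destruct (Hv x Hx) as [y [_ Hy]]. apply (HR (x .: e)). eauto.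
Qed.

Lemma PG_bex n : Bnd n -> forall f R, DF f -> PG n (fun e => R (e O) (fun i => e (S i))) ->
  PG n (fun e => exists x, x < f e /\ R x e).
Proof. intros HB. apply PG_bex_of. now apply SG_ball. Qed.

Lemma SG_sigma n : forall P,
  (SG n P -> exists p, Sigma n p /\ forall e, sat e r p <-> P e) /\
  (PG n P -> exists p, Pi n p /\ forall e, sat e r p <-> P e).
Proof.
  induction n; intros P; [split; auto|].
  split; intros [Q [HQ HP]]; apply IHn in HQ as [q [Hq Hsat]].
  - exists (Ex q). split; [simpl; eauto|]. intros e. rewrite sat_ex, HP. now setoid_rewrite Hsat.
  - exists (All q). split; [simpl; eauto|]. intros e. simpl. rewrite HP. now setoid_rewrite Hsat.
Qed.

Lemma sigma_SG n : forall p,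
  (Sigma n p -> SG n (fun e => sat e r p)) /\ (Pi n p -> PG n (fun e => sat e r p)).
Proof.
  induction n; intros p.
  - split; intros Hp; exists p; (split; [exact Hp|reflexivity]).
  - split; intros [q [-> Hq]]; (exists (fun e => sat e r q)); (split; [now apply IHn|]);
      intros e; [apply sat_ex|reflexivity].
Qed.

Lemma induction_SG1 P e : SG 1 P -> P (0 .: e) -> (forall d, P (d .: e) -> P (d + 1 .: e)) ->
  forall d, P (d .: e).
Proof.
  intros HP H0 HS d. apply (SG_sigma 1) in HP as [p [Hp Hsat]].
  apply Hsat, induction_Sigma1; auto; [now apply Hsat|].
  intros a Ha. now apply Hsat, HS, Hsat.
Qed.

Definition LNP (C : (env -> Prop) -> Prop) : Prop :=
  forall P, C P -> forall e x, P (x .: e) ->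
  exists x, P (x .: e) /\ forall y, y < x -> ~ P (y .: e).

Lemma LNP_D0 : LNP D0.
Proof.
  intros P HP e x Hx. apply NNPP. intros HN.
  enough (H : forall d, forall y, y < d -> ~ P (y .: e)) by exact (H (x + 1) x (lt_S_diag x) Hx).
  intros d. apply (induction_SG1 (fun e => forall y, y < e O -> ~ P (y .: (fun i => e (S i)))) e).
  - apply D0_SG. apply (D0_ball _ (fun y e => ~ P (y .: (fun i => e (S i))))); df.
    apply D0_not. apply (D0_comp (fun e => e O .: (fun i => e (S (S i))))); auto. good.
  - intros y Hy. now apply nlt_0 in Hy.
  - intros a Ha y Hy HPy. apply lt_S in Hy as [Hy|Hy]; [exact (Ha y Hy HPy)|].
    simpl in Hy. subst a. apply HN. exists y. auto.
Qed.

(** Collection bounds the leading quantifier uniformly for all arguments up to [x]. On that range a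
    Σ(n+1) predicate agrees with a Π(n) one and a Π(n+1) predicate with a Σ(n) one, so both
    principles are proved together. *)
Lemma LNP_SPG n : Bnd (S n) -> LNP (SG n) /\ LNP (PG n).
Proof.
  induction n as [|n IHn]; intros HB; [split; apply LNP_D0|].
  destruct (IHn (Bnd_pred _ HB)) as [IHS IHP].
  assert (HBn : Bnd n) by now apply Bnd_pred, Bnd_pred.
  assert (Htl : Good (fun e => (fun i => e (S i)))) by good.
  assert (Hins : Good (fun e => e O .: e (S O) .: (fun i => e (S (S (S i)))))) by good.
  split; intros P HP e x Hx; pose proof HP as [Q [HQ HPQ]].
  (* Collection needs a witness for every [y], including those where [P] fails; the implication
     supplies one and is still Π(n+1). *)
  - destruct (HB (fun e => P (fun i => e (S i)) -> Q e)) with (e := e) (w := x + 1) as [v Hv].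
    + apply PG_SG, PG_imp; [now apply (SG_comp (S n) (fun e i => e (S i)))|now apply PG_S].
    + intros y _. destruct (classic (P (y .: e))) as [Hy|Hy].
      * pose proof Hy as Hu. apply HPQ in Hu as [u Hu]. eauto.
      * exists 0. intros H. now destruct Hy.
    + assert (HE : forall y, y < x + 1 -> P (y .: e) <-> exists u, u < v /\ Q (u .: y .: e)).
      { intros y Hy. split; [|intros [u [_ Hu]]; apply HPQ; eauto].
        intros H. destruct (Hv y Hy) as [u [Hu HQu]]. exists u. auto. }
      destruct (IHP (fun e => exists u, u < e (S O) /\ Q (u .: e O .: (fun i => e (S (S i))))))
        with (e := v .: e) (x := x) as [z [Hz Hmin]].
      * apply (PG_bex n HBn _ (fun u e => Q (u .: e O .: (fun i => e (S (S i)))))); [df|].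
        now apply (PG_comp n _ _ Hins).
      * apply HE; auto using lt_S_diag.
      (* [HE] is known only up to [x]; minimality keeps [z] in that range. *)
      * assert (Hzx : z < x + 1).
        { apply lt_S_le, not_lt. intros H. apply (Hmin x H). apply HE; auto using lt_S_diag. }
        exists z. split; [now apply HE|]. intros y Hy Hy'. apply (Hmin y Hy).
        apply HE; eauto using lt_trans.
  - destruct (HB (fun e => ~ P (fun i => e (S i)) -> ~ Q e)) with (e := e) (w := x + 1) as [v Hv].
    + apply PG_SG, PG_imp; [apply SG_not; now apply (PG_comp (S n) (fun e i => e (S i)))|].
      now apply PG_not, SG_S.
    + intros y _. destruct (classic (P (y .: e))) as [Hy|Hy].
      * exists 0. intros H. now destruct H.
      * pose proof Hy as Hu. rewrite HPQ in Hu. apply not_all_ex_not in Hu as [u Hu]. eauto.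
    + assert (HE : forall y, y < x + 1 -> P (y .: e) <-> forall u, u < v -> Q (u .: y .: e)).
      { intros y Hy. rewrite HPQ. split; [auto|].
        intros H. apply HPQ, NNPP. intros HN. destruct (Hv y Hy) as [u [Hu HQu]].
        now apply HQu; auto. }
      destruct (IHS (fun e => forall u, u < e (S O) -> Q (u .: e O .: (fun i => e (S (S i))))))
        with (e := v .: e) (x := x) as [z [Hz Hmin]].
      * apply (SG_ball n HBn _ (fun u e => Q (u .: e O .: (fun i => e (S (S i)))))); [df|].
        now apply (SG_comp n _ _ Hins).
      * apply HE; auto using lt_S_diag.
      * assert (Hzx : z < x + 1).
        { apply lt_S_le, not_lt. intros H. apply (Hmin x H). apply HE; auto using lt_S_diag. }
        exists z. split; [now apply HE|]. intros y Hy Hy'. apply (Hmin y Hy).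
        apply HE; eauto using lt_trans.
Qed.

Lemma Bnd_1 : Bnd 1.
Proof.
  intros P [Q [HQ HP]] e w H.
  (* One bound [v] serves both [y] and its inner witness [z], which leaves a Δ(0) matrix. The guard
     [x < w] makes the induction step trivial once [d] has passed [w]. *)
  enough (HI : forall d, exists v, forall x, x < d -> x < w ->
    exists y, y < v /\ exists z, z < v /\ Q (z .: y .: x .: e)).
  { destruct (HI w) as [v Hv]. exists v. intros x Hx. destruct (Hv x Hx Hx) as [y [Hy [z [_ Hz]]]].
    exists y. split; auto. apply HP. eauto. }
  intros d. apply (induction_SG1 (fun e => exists v, forall x, x < e O -> x < e (S O) ->
    exists y, y < v /\ exists z, z < v /\ Q (z .: y .: x .: (fun i => e (S (S i)))))
    (w .: e)).
  - apply (SG_ex O (fun v e => forall x, x < e O -> x < e (S O) ->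
      exists y, y < v /\ exists z, z < v /\ Q (z .: y .: x .: (fun i => e (S (S i)))))).
    apply D0_SG.
    apply (D0_ball _ (fun x e => x < e (S (S O)) ->
      exists y, y < e O /\ exists z, z < e O /\ Q (z .: y .: x .: (fun i => e (S (S (S i))))))); [df|].
    apply D0_imp; [apply D0_lt; df|].
    apply (D0_bex _ (fun y e => exists z, z < e (S O) /\ Q (z .: y .: e O .: (fun i => e (S (S (S (S i)))))))); [df|].
    apply (D0_bex _ (fun z e => Q (z .: e O .: e (S O) .: (fun i => e (S (S (S (S (S i))))))))); [df|].
    apply (D0_comp (fun e => e O .: e (S O) .: e (S (S O)) .: (fun i => e (S (S (S (S (S (S i))))))))); auto. good.
  - exists 0. intros x Hx. now apply nlt_0 in Hx.
  - intros a [v Hv]. destruct (classic (a < w)) as [Ha|Ha].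
    + destruct (H a Ha) as [y Hy]. apply HP in Hy as [z Hz].
      exists (v + y + z + 1). intros x Hx Hxw. simpl in Hxw. apply lt_S in Hx as [Hx|Hx].
      * destruct (Hv x Hx Hxw) as [y' [Hy' [z' [Hz' HQ']]]].
        assert (Hle : v <= v + y + z + 1) by (exists (y + z + 1); ring).
        exists y'. split; [eauto using lt_le_trans|]. exists z'. split; eauto using lt_le_trans.
      * simpl in Hx. subst x. exists y. split; [apply lt_S_le; exists (v + z); ring|].
        exists z. split; [apply lt_S_le; exists (v + y); ring|exact Hz].
    + exists v. intros x Hx Hxw. apply lt_S in Hx as [Hx|Hx]; [now apply Hv|].
      simpl in Hx, Hxw. now subst x.
Qed.

(** * Colorings of tuples *)

Implicit Types zs xs : list M.

Fixpoint inc (l : list M) : Prop :=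
  match l with
  | x :: ((y :: _) as l') => x < y /\ inc l'
  | _ => True
  end.

Definition tup (l : list M) : M :=
  match l with [] => 0 | x :: l' => fold_left pair l' x end.

Lemma sat_Increasing e r' ts : sat e r' (Increasing ts) <-> inc (map (ev e) ts).
Proof.
  induction ts as [|t ts IH]; [simpl; tauto|]. destruct ts as [|s ts]; [simpl; tauto|].
  change (Increasing (t :: s :: ts)) with (t ≺ s ∧ Increasing (s :: ts)).
  rewrite sat_and, IH. reflexivity.
Qed.

Lemma ev_Tuple e ts : ev e (Tuple ts) = tup (map (ev e) ts).
Proof.
  destruct ts as [|t ts]; simpl; auto. revert t. induction ts as [|s ts IH]; intros t; simpl; auto.
Qed.

Definition desc zs : Prop := inc (rev zs).
Definition tcode zs : M := tup (rev zs).

Lemma desc_cons x y zs : desc (x :: y :: zs) <-> y < x /\ desc (y :: zs).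
Proof.
  unfold desc. simpl. generalize (rev zs). intros l.
  induction l as [|a l IH]; simpl; [tauto|].
  destruct l; simpl in *; tauto.
Qed.

Lemma tcode_cons x y zs : tcode (x :: y :: zs) = pair (tcode (y :: zs)) x.
Proof.
  unfold tcode. simpl. destruct (rev zs) as [|a l]; simpl; auto.
  now rewrite !fold_left_app.
Qed.

Definition infinite (D : sets M) : Prop := forall x, exists y, mem y D /\ x < y.

(** Environments list a tuple [x1 < ... < xa] as [[xa; ...; x1]], in front of the parameters. *)
Definition FunOn (a : nat) (k : M) e P : Prop := forall zs, length zs = a ->
  exists y, y < k /\ P (y .: eapp zs e) /\ forall y', P (y' .: eapp zs e) -> y' = y.

(** The coloring is a Σ(1) graph, total on all tuples, so that no monotonicity condition has to be
    carried through the limits; only the homogeneity is confined to increasing tuples. As [l] is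
    standard, the colors form an ordinary list. *)
Definition RTsem (n l : nat) : Prop := forall P e k, SG 1 P -> FunOn n k e P ->
  exists D L, infinite D /\ (length L <= l)%nat /\
    forall zs, length zs = n -> desc zs -> Forall (fun x => mem x D) zs ->
    forall y, P (y .: eapp zs e) -> In y L.

Lemma comprehension P Q e : SG 1 P -> PG 1 Q -> (forall x, P (x .: e) <-> Q (x .: e)) ->
  exists D, forall x, mem x D <-> P (x .: e).
Proof.
  intros HP HQ HPQ. apply (SG_sigma 1) in HP as [p [Hp Hsp]]. apply (SG_sigma 1) in HQ as [q [Hq Hsq]].
  pose proof (model_axioms _ (ax_comprehension p q Hp Hq) e r) as H.
  change (sat e r (All (p ⇔ q)) -> sat e r (ExS (All (Var 0 ∈ 0 ⇔ liftS p)))) in H.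
  rewrite sat_exS in H. destruct H as [D HD].
  { intros d. apply sat_iff. now rewrite Hsp, Hsq. }
  exists D. intros x. specialize (HD x). rewrite sat_iff in HD. simpl in HD.
  unfold liftS in HD. rewrite sat_subst in HD. rewrite HD. apply Hsp.
Qed.

(** The longer tuples are colored without regard to their largest entry, and every increasing tuple
    from an infinite set extends within it. *)
Lemma RTsem_pred n l : RTsem (S n) l -> RTsem n l.
Proof.
  intros H P e k HP HF.
  destruct (H (fun e => P (e O .: (fun i => e (S (S i))))) e k) as [D [L [HD [HL Hhom]]]].
  - apply SG_comp; auto. apply Good_cons; auto using DF_var.
    apply (Good_rename (fun i => S (S i))).
  - intros [|z zs] Hl; [discriminate|]. injection Hl as Hl. exact (HF zs Hl).
  - exists D, L. repeat split; auto. intros zs Hl Hd Hm y Hy.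
    (* The default 0 is met only by the empty tuple, which any element of [D] extends. *)
    destruct (HD (match zs with [] => 0 | z :: _ => z end)) as [z [Hz Hlt]].
    apply (Hhom (z :: zs)); simpl; auto.
    destruct zs as [|z' zs]; [exact I|]. apply desc_cons. auto.
Qed.

Lemma DF_comp f G : DF f -> Good G -> DF (fun e => f (G e)).
Proof.
  intros Hf HG. pose proof Hf as [t [Gr [HGr [Hb HF]]]].
  apply bounded_graph with (fun e => ev (G e) t); auto using DF_ev.
  apply D0_ext with (fun e => Gr (e O .: G (fun i => e (S i)))); [intros e; apply HF|].
  apply (D0_comp (fun e => e O .: G (fun i => e (S i)))); auto using Good_up.
Qed.

Lemma Good_comp F G : Good F -> Good G -> Good (fun e => F (G e)).
Proof. intros HF HG i. apply (DF_comp (fun e => F e i)); auto. Qed.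

(** The entries come out last first: this is the order of the variables under [n+1] quantifiers. *)
Fixpoint untuple (n : nat) e : env :=
  match n with
  | O => e
  | S m => pi2 (e O) .: untuple m (pi1 (e O) .: (fun i => e (S i)))
  end.

Lemma Good_untuple n : Good (untuple n).
Proof.
  induction n; simpl; [apply (Good_rename (fun i => i))|].
  apply Good_cons; [apply DF_pi2, DF_var|].
  apply Good_comp; auto. apply Good_cons; [apply DF_pi1, DF_var|apply Good_rename].
Qed.

Lemma untuple_tcode n zs e : length zs = S n -> untuple n (tcode zs .: e) = eapp zs e.
Proof.
  revert zs. induction n; intros zs Hl.
  - destruct zs as [|z [|]]; try discriminate. reflexivity.
  - destruct zs as [|z [|z' zs]]; try discriminate. rewrite tcode_cons.
    simpl untuple. rewrite pi2_pair, pi1_pair.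
    injection Hl as Hl. exact (f_equal (scons z) (IHn (z' :: zs) (f_equal S Hl))).
Qed.

(** The projections are total, so every number decodes to some tuple, code or not. Whether it was a
    code is tested by [tuple_form], which encodes the result again and compares. *)
Lemma untuple_eapp n : forall a, exists zs, length zs = S n /\
  forall e, untuple n (a .: e) = eapp zs e.
Proof.
  induction n; intros a.
  - exists [a]. auto.
  - destruct (IHn (pi1 a)) as [zs [Hl H]]. exists (pi2 a :: zs). split; [simpl; auto|].
    intros e. simpl. now rewrite <- H.
Qed.

Definition tuple_form (n : nat) : form :=
  Increasing (vars 1 n) ∧ Var (n + 1) ≐ Pair (Tuple (vars 1 n)) (Var 0).

Lemma Increasing_Delta0 ts : Delta0 (Increasing ts).
Proof.
  induction ts as [|t ts IH]; [repeat constructor|]. destruct ts as [|s ts]; [repeat constructor|].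
  change (Delta0 (t ≺ s ∧ Increasing (s :: ts))). repeat constructor. exact IH.
Qed.

Lemma sat_tuple_form n zs y c e r' : length zs = n ->
  sat (y .: eapp zs (c .: e)) r' (tuple_form n) <-> desc zs /\ c = pair (tcode zs) y.
Proof.
  intros Hl. unfold tuple_form. rewrite sat_and, sat_Increasing.
  pose proof (ev_vars [y] zs (c .: e) n Hl) as HV.
  change (eapp ([y] ++ zs) (c .: e)) with (y .: eapp zs (c .: e)) in HV.
  change (length [y]) with (S O) in HV. rewrite HV.
  cbn [sat]. change (ev ?f (Pair ?a ?b)) with (pair (ev f a) (ev f b)).
  rewrite ev_Tuple, HV. cbn [ev scons].
  replace ((y .: eapp zs (c .: e)) (n + 1)%nat) with c; [reflexivity|].
  subst n. rewrite Nat.add_1_r. simpl. rewrite <- (Nat.add_0_r (length zs)) at 1.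
  now rewrite eapp_plus.
Qed.

Lemma sat_Coloring n k e D r' :
  (forall c, mem c D -> exists zs y, length zs = n /\ desc zs /\ y < k /\ c = pair (tcode zs) y) ->
  (forall zs, length zs = n -> desc zs -> exists y, mem (pair (tcode zs) y) D /\
    forall y', mem (pair (tcode zs) y') D -> y' = y) ->
  sat (k .: e) (D .: r') (Coloring n (Var 0) 0).
Proof.
  intros H1 H2. unfold Coloring. rewrite sat_and, sat_Alls. split.
  - intros c Hc. destruct (H1 c Hc) as [zs [y [Hl [Hd [Hy Hcode]]]]].
    rewrite sat_Exs. exists zs. split; [exact Hl|]. rewrite sat_ex. exists y.
    pose proof (proj2 (sat_tuple_form n zs y c (k .: e) (D .: r') Hl) (conj Hd Hcode)) as HT.
    unfold tuple_form in HT. rewrite !sat_and in *. repeat split; try apply HT.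
    assert (HK : (y .: eapp zs (c .: k .: e)) (n + 2 + O)%nat = k).
    { replace (n + 2 + O)%nat with (S (length zs + 1)) by lia. simpl. now rewrite eapp_plus. }
    unfold tlift. cbn [sat tsubst ev]. rewrite HK. exact Hy.
  - intros zs Hl. cbn [sat]. rewrite sat_Increasing, (ev_vars [] zs _ n Hl).
    intros Hd. rewrite sat_ExUnique. cbn [sat].
    pose proof (fun y => ev_vars [y] zs (k .: e) n Hl) as HV.
    destruct (H2 zs Hl Hd) as [y [Hy Hu]]. exists y.
    assert (HE : forall y, ev (y .: eapp zs (k .: e)) (Pair (Tuple (vars 1 n)) (Var 0)) = pair (tcode zs) y).
    { intros y'. change (ev ?f (Pair ?a ?b)) with (pair (ev f a) (ev f b)).
      rewrite ev_Tuple. specialize (HV y'). simpl in HV. now rewrite HV. }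
    setoid_rewrite HE. auto.
Qed.

Lemma sat_Image n y r' e zs : length zs = n -> desc zs ->
  Forall (fun x => mem x (r' 0%nat)) zs -> mem (pair (tcode zs) y) (r' 1%nat) ->
  sat (y .: e) r' (Image n 1 0).
Proof.
  intros Hl Hd HF Hm. unfold Image. rewrite sat_Exs. exists zs. split; [exact Hl|].
  pose proof (ev_vars [] zs (y .: e) n Hl) as HV. simpl in HV.
  rewrite !sat_and, sat_Increasing, sat_BigAnd, HV. repeat split; auto.
  - now apply Forall_rev.
  - cbn [sat]. change (ev ?f (Pair ?a ?b)) with (pair (ev f a) (ev f b)).
    rewrite ev_Tuple, HV. cbn [ev]. rewrite <- Hl, <- (Nat.add_0_r (length zs)), eapp_plus. exact Hm.
Qed.

Lemma sat_RT n l e r' : sat e r' (RT (S n) l) -> RTsem (S n) l.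
Proof.
  intros H P e0 k HP HF.
  (* [F] replaces a number by the value and the tuple decoded from it. [A] also keeps the number
     itself behind the tuple, for the comparison made by [tuple_form]. *)
  set (F := fun e : env => pi2 (e O) .: untuple n (pi1 (e O) .: (fun i => e (S i)))).
  set (A := fun e : env => sat (pi2 (e O) .: untuple n (pi1 (e O) .: e)) r (tuple_form (S n))).
  assert (HGF : Good F).
  { apply Good_cons; [apply DF_pi2, DF_var|]. apply Good_comp; [apply Good_untuple|].
    apply Good_cons; [apply DF_pi1, DF_var|apply Good_rename]. }
  assert (HA : D0 A).
  { apply (D0_comp (fun e => pi2 (e O) .: untuple n (pi1 (e O) .: e))
      (fun e => sat e r (tuple_form (S n)))).
    - apply Good_cons; [apply DF_pi2, DF_var|]. apply Good_comp; [apply Good_untuple|].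
      apply Good_cons; [apply DF_pi1, DF_var|apply (Good_rename (fun i => i))].
    - exists (tuple_form (S n)). split; [|reflexivity].
      unfold tuple_form. repeat constructor. apply Increasing_Delta0. }
  assert (HPF : SG 1 (fun e => P (F e))) by now apply SG_comp.
  assert (HAF : forall c, A (c .: e0) -> exists zs y, length zs = S n /\ desc zs /\
    c = pair (tcode zs) y /\ forall y', y' .: (fun i => F (c .: e0) (S i)) = y' .: eapp zs e0).
  { intros c Hc. destruct (untuple_eapp n (pi1 c)) as [zs [Hl Hzs]].
    unfold A in Hc. simpl in Hc. rewrite Hzs in Hc.
    apply sat_tuple_form in Hc as [Hd Hc]; auto.
    exists zs, (pi2 c). repeat split; auto. intros y'. f_equal. apply Hzs. }
  assert (HFA : forall zs y, length zs = S n -> desc zs -> A (pair (tcode zs) y .: e0) /\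
    F (pair (tcode zs) y .: e0) = y .: eapp zs e0).
  { intros zs y Hl Hd. unfold A, F. simpl. rewrite pi2_pair, pi1_pair, !untuple_tcode; auto.
    split; [|reflexivity]. now apply sat_tuple_form. }
  (* Uniqueness of the value supplies the Π(1) form: every value at the decoded tuple is the decoded
     one. *)
  destruct (comprehension (fun e => A e /\ P (F e))
    (fun e => A e /\ forall y', P (y' .: (fun i => F e (S i))) -> y' = pi2 (e O)) e0) as [C HC].
  - apply SG_and; auto. now apply D0_SG.
  - apply PG_and; [now apply D0_PG|].
    apply (PG_all O (fun y e => P (y .: (fun i => F e (S i))) -> y = pi2 (e O))).
    apply PG_imp; [|apply D0_PG, D0_eq; [apply DF_var|apply DF_pi2, DF_var]].
    apply (SG_comp 1 (fun e => e O .: (fun i => F (fun i => e (S i)) (S i)))); auto.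
    apply Good_cons; [apply DF_var|]. intros i. apply (DF_rename S (fun e => F e (S i))), HGF.
  - intros c.
    enough (A (c .: e0) -> P (F (c .: e0)) <->
      forall y', P (y' .: (fun i => F (c .: e0) (S i))) -> y' = pi2 c) by (simpl; tauto).
    intros Hc. destruct (HAF c Hc) as [zs [y [Hl [Hd [Hcode HE]]]]]. setoid_rewrite HE.
    destruct (HFA zs y Hl Hd) as [_ HF']. rewrite <- Hcode in HF'. rewrite HF', Hcode, pi2_pair.
    destruct (HF zs Hl) as [y0 [_ [HPy Hu]]]. split.
    + intros HPy1 y' HPy'. rewrite (Hu y HPy1). now apply Hu.
    + intros HN. now rewrite <- (HN y0 HPy).
  - assert (HCE : forall zs y, length zs = S n -> desc zs ->
      mem (pair (tcode zs) y) C <-> P (y .: eapp zs e0)).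
    { intros zs y Hl Hd. rewrite HC. destruct (HFA zs y Hl Hd) as [HA1 ->]. tauto. }
    specialize (H k C). cbn [sat] in H. rewrite sat_exS in H.
    destruct H as [D HD].
    { apply sat_Coloring.
      - intros c Hc. apply HC in Hc as [Hc HPc]. destruct (HAF c Hc) as [zs [y [Hl [Hd [-> _]]]]].
        exists zs, y. repeat split; auto. destruct (HF zs Hl) as [y' [Hy' [_ Hu]]].
        destruct (HFA zs y Hl Hd) as [_ HE]. rewrite HE in HPc. now rewrite (Hu y HPc).
      - intros zs Hl Hd. destruct (HF zs Hl) as [y [Hy [HPy Hu]]]. exists y. 
        split; [now apply HCE|]. intros y' Hy'. apply Hu. now apply HCE in Hy'. }
    rewrite sat_and, sat_CardLe in HD. destruct HD as [Hinf [L [HL Himg]]].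
    exists D, L. split; [|split; [lia|]].
    + intros x. specialize (Hinf x). rewrite sat_ex in Hinf. destruct Hinf as [y Hy].
      rewrite sat_and in Hy. exists y. exact Hy.
    + intros zs Hl Hd HFm y HPy. apply Himg. eapply sat_Image; eauto. now apply HCE.
Qed.

(** * Iterated limits *)

(** Only bounded searches enter the approximation: survival of a candidate below [s] is Σ(m) by
    collection, and its minimality is Π(m), so [Q] comes out Σ(m+1), one level below [P]. *)
Lemma limit_step m a P e : Bnd (S (S m)) -> SG (S (S m)) P -> FunOn a (e O) e P ->
  exists Q, SG (S m) Q /\ FunOn (S a) (e O) e Q /\
    forall xs, length xs = a -> exists s0, forall s, s0 < s -> forall y,
      Q (y .: s .: eapp xs e) -> P (y .: eapp xs e).
Proof.
  intros HB HP HF. assert (HB1 := Bnd_pred _ HB). assert (HB0 := Bnd_pred _ HB1).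
  destruct HP as [R [[T [HT HR]] HP]].
  (* A candidate with too large a first component might survive for a while; the first clause keeps
     the values of [Q] among the colors. Variable [a + 2] is the number of colors, behind [p], [s]
     and the [a] arguments. *)
  set (G := fun e : env => pi1 (e O) < e (S (S a)) /\ forall w, w < e (S O) ->
    T (w .: pi2 (e O) .: pi1 (e O) .: (fun i => e (S (S i))))).
  assert (HG : SG m G).
  { apply SG_and; [apply D0_SG, D0_lt; df|].
    apply (SG_ball m HB0 _ (fun w e => T (w .: pi2 (e O) .: pi1 (e O) .: (fun i => e (S (S i)))))); [df|].
    apply (SG_comp m (fun e => e O .: pi2 (e (S O)) .: pi1 (e (S O)) .: (fun i => e (S (S (S i)))))); auto.
    good. }
  (* When no candidate below [s] survives, the value defaults to 0. This is a color, because [P]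
     takes some value below the bound. *)
  set (Q := fun e : env =>
    (exists p, p < e (S O) /\ pi1 p = e O /\ G (p .: (fun i => e (S i))) /\
      forall p', p' < p -> ~ G (p' .: (fun i => e (S i)))) \/
    (e O = 0 /\ forall p, p < e (S O) -> ~ G (p .: (fun i => e (S i))))).
  assert (HQ : SG (S m) Q).
  { apply SG_or.
    - apply (SG_bex (S m) _ (fun p e => pi1 p = e O /\ G (p .: (fun i => e (S i))) /\
        forall p', p' < p -> ~ G (p' .: (fun i => e (S i))))); [df|].
      apply SG_and; [apply D0_SG, D0_eq; df|]. apply SG_and.
      + apply SG_S. apply (SG_comp m (fun e => e O .: (fun i => e (S (S i))))); auto. good.
      + apply PG_SG, (PG_ball m _ (fun p' e => ~ G (p' .: (fun i => e (S (S i)))))); [df|].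
        apply PG_not. apply (SG_comp m (fun e => e O .: (fun i => e (S (S (S i)))))); auto. good.
    - apply SG_and; [apply D0_SG, D0_eq; df|].
      apply PG_SG, (PG_ball m _ (fun p' e => ~ G (p' .: (fun i => e (S i))))); [df|].
      apply PG_not. apply (SG_comp m (fun e => e O .: (fun i => e (S (S i))))); auto. good. }
  destruct (LNP_SPG m HB1) as [LS _]. destruct (LNP_SPG (S m) HB) as [_ LP].
  assert (Hk : forall xs, length xs = a -> eapp xs e a = e O).
  { intros xs Hl. rewrite <- Hl, <- (Nat.add_0_r (length xs)). apply eapp_plus. }
  exists Q. split; [exact HQ|]. split.
  - intros [|s xs] Hl; [discriminate|]. injection Hl as Hl.
    simpl eapp. set (e' := eapp xs e) in *.
    destruct (classic (exists p, p < s /\ G (p .: s .: e'))) as [[p0 [Hp0 HGp0]]|HN].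
    + destruct (LS G HG _ _ HGp0) as [p [HGp Hmin]].
      assert (Hps : p < s).
      { apply le_lt_trans with p0; auto. apply not_lt. intros H. exact (Hmin _ H HGp0). }
      exists (pi1 p). split; [|split].
      * destruct HGp as [Hp _]. simpl in Hp. now rewrite <- (Hk xs Hl).
      * left. exists p. auto.
      * intros y' [[p' [Hp' [Hy [HGp' Hmin']]]]|[_ HN]]; [|now destruct (HN p Hps)].
        simpl in Hy. rewrite <- Hy. f_equal.
        destruct (trichotomy p p') as [H|[H|H]]; auto; exfalso;
          [exact (Hmin' _ H HGp)|exact (Hmin _ H HGp')].
    + destruct (HF xs Hl) as [y [Hy _]]. exists 0. split; [|split].
      * apply le_lt_trans with y; auto using le_0.
      * right. split; [reflexivity|]. intros p Hp HGp. eauto.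
      * intros y' [[p' [Hp' [_ [HGp' _]]]]|[Hy' _]]; [|exact Hy']. exfalso; eauto.
  - intros xs Hl. specialize (Hk xs Hl). set (e' := eapp xs e) in *.
    destruct (HF xs Hl) as [y [Hy [HPy Hu]]]. fold e' in HPy, Hu.
    pose proof HPy as Hz. apply HP in Hz as [z Hz].
    (* [p] is the least candidate that is never refuted; by uniqueness of the value its first
       component is [y]. *)
    destruct (LP (fun e => R (pi2 (e O) .: pi1 (e O) .: (fun i => e (S i))))) with (e := e') (x := pair y z)
      as [p [Hp Hmin]].
    { apply (PG_comp (S m) (fun e => pi2 (e O) .: pi1 (e O) .: (fun i => e (S i)))); [good|].
      now exists T. }
    { simpl. now rewrite pi1_pair, pi2_pair. }
    assert (Hpy : pi1 p = y) by (apply Hu, HP; eauto).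
    (* Each smaller candidate is refuted somewhere, and collection bounds all these refutations by
       [v]. Past [v + p] none of them survives, while [p] itself lies in the range of the search. *)
    destruct (HB1 (fun e => ~ T (e O .: pi2 (e (S O)) .: pi1 (e (S O)) .: (fun i => e (S (S i))))))
      with (e := e') (w := p) as [v Hv].
    { apply PG_SG, PG_not.
      apply (SG_comp m (fun e => e O .: pi2 (e (S O)) .: pi1 (e (S O)) .: (fun i => e (S (S i))))); auto.
      good. }
    { intros p' Hp'. specialize (Hmin _ Hp'). rewrite HR in Hmin.
      now apply not_all_ex_not in Hmin. }
    exists (v + p). intros s Hs y' HQ'.
    assert (HGp : G (p .: s .: e')).
    { split; [simpl; congruence|]. intros w _. now apply HR. }
    assert (HNG : forall p', p' < p -> ~ G (p' .: s .: e')).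
    { intros p' Hp' [_ HG']. destruct (Hv p' Hp') as [w [Hw HNT]]. apply HNT, HG'. simpl.
      eauto using lt_trans, le_lt_trans, le_add_r. }
    assert (Hps : p < s) by eauto using le_lt_trans, le_add_l.
    destruct HQ' as [[p' [_ [Hy' [HG' Hmin']]]]|[_ HN]]; [|now destruct (HN p Hps)].
    simpl in Hy'. replace y' with y; auto. rewrite <- Hy', <- Hpy. f_equal.
    destruct (trichotomy p p') as [H|[H|H]]; auto; exfalso;
      [exact (Hmin' _ H HGp)|exact (HNG _ H HG')].
Qed.

(** Given the arguments, one suitable tuple from [D] is enough. Its entries are picked from the
    smallest up, each past the threshold determined by the earlier ones and above [b], the largest
    entry so far. *)
Lemma iterated_limit m : forall a P e, Bnd (S m) -> SG (S m) P -> FunOn a (e O) e P ->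
  exists Q, SG 1 Q /\ FunOn (m + a)%nat (e O) e Q /\
    forall D, infinite D -> forall xs b, length xs = a ->
    exists zs, length zs = m /\ desc (zs ++ [b]) /\ Forall (fun x => mem x D) zs /\
      forall y, Q (y .: eapp (zs ++ xs) e) -> P (y .: eapp xs e).
Proof.
  induction m; intros a P e HB HP HF.
  - exists P. repeat split; auto. intros D HD xs b Hl. exists []. repeat split; auto.
  - destruct (limit_step m a P e HB HP HF) as [Q1 [HQ1 [HF1 Hlim]]].
    destruct (IHm (S a) Q1 e (Bnd_pred _ HB) HQ1 HF1) as [Q [HQ [HFQ Happ]]].
    exists Q. split; [exact HQ|]. split; [now rewrite <- Nat.add_succ_comm in *|].
    intros D HD xs b Hl. destruct (Hlim xs Hl) as [s0 Hs0].
    destruct (HD (s0 + b)) as [s [Hs Hlt]].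
    destruct (Happ D HD (s :: xs) s) as [zs [Hlz [Hd [Hm HQP]]]]; [simpl; auto|].
    exists (zs ++ [s]). repeat split.
    + rewrite length_app, Hlz. apply Nat.add_1_r.
    + unfold desc in *. rewrite !rev_app_distr in *. simpl. split; [|exact Hd].
      eauto using le_lt_trans, le_add_l.
    + apply Forall_app. auto.
    + intros y Hy. rewrite <- app_assoc in Hy. apply (Hs0 s); [eauto using le_lt_trans, le_add_r|].
      apply HQP, Hy.
Qed.

Lemma homogeneous m l P e : RTsem (S m) l -> Bnd (S m) -> SG (S m) P -> FunOn 1 (e O) e P ->
  exists D L, infinite D /\ (length L <= l)%nat /\
    forall h, mem h D -> exists y, In y L /\ P (y .: h .: e).
Proof.
  intros HRT HB HP HF. destruct (iterated_limit m 1 P e HB HP HF) as [Q [HQ [HFQ Happ]]].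
  rewrite Nat.add_1_r in HFQ. destruct (HRT Q e (e O) HQ HFQ) as [D [L [HD [HL Hhom]]]].
  exists D, L. repeat split; auto. intros h Hh.
  destruct (Happ D HD [h] h eq_refl) as [zs [Hl [Hd [Hm HQP]]]].
  assert (Hl' : length (zs ++ [h]) = S m) by (rewrite length_app, Hl; apply Nat.add_1_r).
  destruct (HFQ (zs ++ [h]) Hl') as [y [_ [HQy _]]]. exists y. split; [|apply HQP, HQy].
  apply (Hhom (zs ++ [h])); auto. apply Forall_app. auto.
Qed.

(** The list is standard, so the bound comes from induction in the metatheory, for an arbitrary
    relation [C]. *)
Lemma list_bound_witness (C : M -> M -> Prop) L : (forall x, In x L -> exists p, C x p) ->
  exists b, forall x, In x L -> exists p, p < b /\ C x p.
Proof.
  induction L as [|x L IH]; intros H; [exists 0; intros x []|].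
  destruct IH as [b Hb]; [intros; apply H; now right|].
  destruct (H x (or_introl eq_refl)) as [p Hp].
  exists (b + p + 1). intros x' [<-|Hx'].
  - exists p. split; auto. apply lt_S_le, le_add_l.
  - destruct (Hb x' Hx') as [p' [Hp' HC]]. exists p'. split; auto.
    apply lt_le_trans with b; auto. exists (p + 1). ring.
Qed.

Lemma Bnd_step m l : Bnd (S m) -> RTsem (S m) l -> Bnd (S (S m)).
Proof.
  intros HB HRT P0 [psi [Hpsi HP0]] e w Htot. assert (HB0 := Bnd_pred _ HB).
  apply NNPP. intros HN.
  (* A code [p] joins [y] with its own witness, which leaves a Π(m+1) predicate; bounding [p] also
     bounds [y]. *)
  set (psi' := fun e : env => psi (pi2 (e O) .: pi1 (e O) .: (fun i => e (S i)))).
  assert (Hpsi' : PG (S m) psi').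
  { apply (PG_comp (S m) (fun e => pi2 (e O) .: pi1 (e O) .: (fun i => e (S i)))); auto. good. }
  assert (Htot' : forall x, x < w -> exists p, psi' (p .: x .: e)).
  { intros x Hx. destruct (Htot x Hx) as [y Hy]. apply HP0 in Hy as [z Hz].
    exists (pair y z). unfold psi'. simpl. now rewrite pi1_pair, pi2_pair. }
  assert (HN' : forall v, exists x, x < w /\ forall p, p < v -> ~ psi' (p .: x .: e)).
  { intros v. apply NNPP. intros H. apply HN. exists v. intros x Hx.
    apply NNPP. intros H'. apply H. exists x. split; auto. intros p Hp Hpsip. apply H'.
    exists (pi1 p). split; [eauto using le_lt_trans, pi1_le|]. apply HP0. eauto. }
  set (V := fun e : env => e O < e (S (S O)) /\
    forall p, p < e (S O) -> ~ psi' (p .: e O .: (fun i => e (S (S (S i)))))).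
  assert (HV : SG (S m) V).
  { apply SG_and; [apply D0_SG, D0_lt; df|].
    apply (SG_ball (S m) HB _ (fun p e => ~ psi' (p .: e O .: (fun i => e (S (S (S i))))))); [df|].
    apply SG_not. apply (PG_comp (S m) (fun e => e O .: e (S O) .: (fun i => e (S (S (S (S i))))))); auto.
    good. }
  destruct HV as [U [HU HV]].
  set (U' := fun e : env => U (pi2 (e O) .: pi1 (e O) .: (fun i => e (S i)))).
  assert (HU' : PG m U').
  { apply (PG_comp m (fun e => pi2 (e O) .: pi1 (e O) .: (fun i => e (S i)))); auto. good. }
  (* Uniformization by the least code of [x] together with a witness for [V]. The code exists by the
     least number principle for Π(m), and its minimality is Σ(m) by collection, so [F] stays
     Σ(m+1). *)
  set (F := fun e : env => exists p, pi1 p = e O /\ U' (p .: (fun i => e (S i))) /\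
    forall p', p' < p -> ~ U' (p' .: (fun i => e (S i)))).
  assert (HSF : SG (S m) F).
  { apply (SG_ex m (fun p e => pi1 p = e O /\ U' (p .: (fun i => e (S i))) /\
      forall p', p' < p -> ~ U' (p' .: (fun i => e (S i))))).
    apply SG_and; [apply D0_SG, D0_eq; df|]. apply SG_and.
    - apply PG_SG. apply (PG_comp m (fun e => e O .: (fun i => e (S (S i))))); auto. good.
    - apply SG_S. apply (SG_ball m HB0 _ (fun p' e => ~ U' (p' .: (fun i => e (S (S i)))))); [df|].
      apply SG_not. apply (PG_comp m (fun e => e O .: (fun i => e (S (S (S i)))))); auto. good. }
  (* [w] acts both as the number of colors and as the parameter of [V] that bounds [x]. *)
  set (e1 := w .: e).
  assert (HFV : forall x v, F (x .: v .: e1) -> V (x .: v .: e1)).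
  { intros x v [p [Hp [HUp _]]]. simpl in Hp. subst x. apply HV. exists (pi2 p). exact HUp. }
  assert (HFF : FunOn 1 (e1 O) e1 F).
  { intros [|v [|]] Hl; try discriminate. simpl eapp.
    destruct (HN' v) as [x [Hx Hxv]].
    assert (HVx : V (x .: v .: e1)) by (split; assumption).
    apply HV in HVx as [t Ht].
    destruct (LNP_SPG m HB) as [_ LP].
    destruct (LP U' HU' (v .: e1) (pair x t)) as [p [Hp Hmin]].
    { unfold U'. simpl. now rewrite pi1_pair, pi2_pair. }
    assert (HFp : F (pi1 p .: v .: e1)) by (exists p; auto).
    exists (pi1 p). split; [exact (proj1 (HFV _ _ HFp))|]. split; [exact HFp|].
    intros y' [p' [Hp' [HU1 Hmin']]]. simpl in Hp'. rewrite <- Hp'. f_equal.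
    destruct (trichotomy p p') as [H|[H|H]]; auto; exfalso;
      [exact (Hmin' _ H Hp)|exact (Hmin _ H HU1)]. }
  destruct (homogeneous m l F e1 HRT HB HSF HFF) as [D [L [HD [_ Hhom]]]].
  (* [L] may contain numbers that are not below [w], for which no witness is promised; the guard
     covers them. *)
  destruct (list_bound_witness (fun x p => x < w -> psi' (p .: x .: e)) L) as [b Hb].
  { intros x _. destruct (classic (x < w)) as [Hx|Hx]; [|exists 0; tauto].
    destruct (Htot' x Hx) as [p Hp]. eauto. }
  destruct (HD b) as [h [Hh Hbh]]. destruct (Hhom h Hh) as [x [HxL HFx]].
  destruct (HFV _ _ HFx) as [Hxw HxV]. destruct (Hb x HxL) as [p [Hp Hpsip]].
  apply (HxV p); [simpl; eauto using lt_trans|]. exact (Hpsip Hxw).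
Qed.

Lemma Bnd_RTsem m l : RTsem (S m) l -> Bnd (S (S m)).
Proof.
  induction m; intros H; apply Bnd_step with l; auto using Bnd_1, RTsem_pred.
Qed.

(** * Codes of finite sets *)

Definition divides x y : Prop := exists q, x * q = y.

(** Provides the parameter of Gödel's β-function. Bounding the quotient by [m] keeps the induction
    formula Σ(1), and positivity of [m] makes every modulus [m (i + 1) + 1] exceed 1. *)
Lemma common_multiple k : exists m, 0 < m /\ forall i, i < k -> divides (i + 1) m.
Proof.
  enough (H : exists m, 0 < m /\ forall i, i < k -> exists q, q < m + 1 /\ (i + 1) * q = m).
  { destruct H as [m [Hm H]]. exists m. split; auto. intros i Hi.
    destruct (H i Hi) as [q [_ Hq]]. now exists q. }
  apply (induction_SG1 (fun e => exists m, 0 < m /\ forall i, i < e O ->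
    exists q, q < m + 1 /\ (i + 1) * q = m) (fun _ => 0)).
  - apply (SG_ex O (fun m e => 0 < m /\ forall i, i < e O -> exists q, q < m + 1 /\ (i + 1) * q = m)).
    apply D0_SG, D0_and; [apply D0_lt; df|].
    apply (D0_ball _ (fun i e => exists q, q < e O + 1 /\ (i + 1) * q = e O)); [df|].
    apply (D0_bex _ (fun q e => (e O + 1) * q = e (S O))); [df|].
    apply D0_eq; df.
  - exists 1. split; [apply lt_le; exists 0; ring|]. intros i Hi. now apply nlt_0 in Hi.
  - intros d [m [Hm H]]. exists (m * (d + 1)). split.
    + apply lt_le_trans with m; auto. exists (m * d). ring.
    + intros i Hi. simpl in Hi. apply lt_S in Hi as [Hi| ->].
      * destruct (H i Hi) as [q [_ Hq]]. exists (q * (d + 1)).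
        assert (E : (i + 1) * (q * (d + 1)) = m * (d + 1)) by (rewrite <- Hq; ring).
        split; auto. apply lt_S_le. rewrite <- E. exists (i * (q * (d + 1))). ring.
      * exists m. split; [apply lt_S_le; exists (m * d); ring|ring].
Qed.

(** In place of subtraction the quotients [q] and [v] are compared; [q < v] forces [u] to be 0. *)
Lemma divides_add_cancel x u v : divides x (u + x * v) -> divides x u.
Proof.
  intros [q Hq]. destruct (classic (q < v)) as [H|H].
  - apply lt_le in H as [t <-]. exists 0.
    assert (E : u + x * (1 + t) = 0).
    { apply (add_cancel_l _ _ (x * q)). rewrite add_0_r.
      transitivity (u + x * (q + 1 + t)); [ring|now symmetry]. }
    apply add_eq_0 in E as [-> _]. ring.
  - apply not_lt in H as [t <-]. exists t. apply (add_cancel_r _ _ (x * v)). rewrite <- Hq. ring.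
Qed.

Lemma beta_coprime k m i j x : (forall i, i < k -> divides (i + 1) m) ->
  i < k -> j < k -> i <> j ->
  divides (m * (i + 1) + 1) ((m * (j + 1) + 1) * x) -> divides (m * (i + 1) + 1) x.
Proof.
  intros Hm Hi Hj Hij [q Hq]. set (A := m * (i + 1) + 1) in *.
  (* With [B = m (j + 1) + 1], [(j + 1) A - (i + 1) B = j - i], which divides [m]. *)
  assert (HE : exists d, d < k /\ divides A ((d + 1) * x)).
  { destruct (trichotomy i j) as [H|[H|H]]; [|tauto|];
      apply lt_le in H as [d E]; exists d.
    - split; [apply le_lt_trans with j; auto; rewrite <- E; apply le_add_l|].
      apply divides_add_cancel with ((i + 1) * q). exists ((j + 1) * x).
      replace (A * ((i + 1) * q)) with ((i + 1) * (A * q)) by ring.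
      rewrite Hq. unfold A. rewrite <- E. ring.
    - split; [apply le_lt_trans with i; auto; rewrite <- E; apply le_add_l|].
      apply divides_add_cancel with ((j + 1) * x). exists ((i + 1) * q).
      replace (A * ((i + 1) * q)) with ((i + 1) * (A * q)) by ring.
      rewrite Hq. unfold A. rewrite <- E. ring. }
  (* As [d + 1] divides [m], [A] divides [m (i + 1) x]. Adding [x] to this gives [A x], so [A]
     divides [x] as well. *)
  destruct HE as [d [Hd [t Ht]]]. destruct (Hm d Hd) as [u Hu].
  apply (divides_add_cancel A x (t * u * (i + 1))).
  exists x. replace (A * (t * u * (i + 1))) with (A * t * (u * (i + 1))) by ring.
  rewrite Ht. unfold A. rewrite <- Hu. ring.
Qed.

Lemma list_upper_bound L : exists k, forall x, In x L -> x < k.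
Proof.
  destruct (list_bound_witness (fun x p => p = x) L) as [b Hb]; [eauto|].
  exists b. intros x Hx. destruct (Hb x Hx) as [p [Hp <-]]. exact Hp.
Qed.

Lemma sat_FMem e r' a b : sat e r' (Var a ∈f Var b) <-> exists k m n,
  e b = pair k (pair m n) /\ e a < k /\ divides (m * (e a + 1) + 1) n.
Proof.
  unfold FMem. rewrite sat_ex. apply Morphisms_Prop.ex_iff_morphism. intros k.
  rewrite sat_ex. apply Morphisms_Prop.ex_iff_morphism. intros m.
  rewrite sat_ex. apply Morphisms_Prop.ex_iff_morphism. intros n.
  rewrite !sat_and, sat_ex. reflexivity.
Qed.

(** The number [N L] is the product of the moduli of the entries. By [beta_coprime] the factors with
    other indices can be cancelled one by one, so the modulus of an [i] outside [L] would have to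
    divide 1. *)
Lemma finite_set_code L : exists s, forall i, (exists k m n,
  s = pair k (pair m n) /\ i < k /\ divides (m * (i + 1) + 1) n) <-> In i L.
Proof.
  destruct (list_upper_bound L) as [k Hk]. destruct (common_multiple k) as [m [Hm Hdiv]].
  set (N := fold_right (fun a N => (m * (a + 1) + 1) * N) 1).
  assert (HN : forall i l, In i l -> divides (m * (i + 1) + 1) (N l)).
  { intros i l. induction l as [|a l IH]; intros []; simpl.
    - subst a. now exists (N l).
    - destruct IH as [q Hq]; auto. exists ((m * (a + 1) + 1) * q). rewrite <- Hq. ring. }
  assert (HN' : forall i l, i < k -> (forall a, In a l -> a < k) ->
    divides (m * (i + 1) + 1) (N l) -> In i l).
  { intros i l Hi. induction l as [|a l IH]; simpl; intros Hl HD.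
    (* The empty product is 1, and a modulus exceeds 1 because [m] is positive. *)
    - destruct HD as [q Hq]. destruct (zero_or_succ m) as [->|[m' ->]]; [now apply lt_irrefl in Hm|].
      destruct (zero_or_succ q) as [->|[q' ->]].
      + apply (succ_neq0 0). transitivity (((m' + 1) * (i + 1) + 1) * 0); [rewrite Hq|]; ring.
      + apply (succ_neq0 (((m' + 1) * (i + 1) + 1) * q' + m' * i + m' + i)), (add_cancel_r _ _ 1).
        transitivity (((m' + 1) * (i + 1) + 1) * (q' + 1)); [|rewrite Hq]; ring.
    - destruct (classic (a = i)) as [E|E]; auto. right. apply IH; auto.
      apply (beta_coprime k m i a); auto. }
  exists (pair k (pair m (N L))). intros i. split.
  - intros [k' [m' [n' [E [Hi HD]]]]]. apply pair_inj in E as [<- E]. apply pair_inj in E as [<- <-].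
    apply HN'; auto.
  - intros Hi. exists k, m, (N L). auto.
Qed.

End Model.

(** * The theorem *)

(** Serves to discard the numbers at or above [k], which [homogeneous] does not exclude from its
    list of colors. *)
Lemma filter_prop {A} (C : A -> Prop) L : exists L', (forall y, In y L' <-> In y L /\ C y) /\
  length L' <= length L.
Proof.
  induction L as [|x L [L' [HL Hlen]]]; [exists []; simpl; split; [tauto|auto]|].
  destruct (classic (C x)) as [Hx|Hx].
  - exists (x :: L'). simpl. split; [|lia]. intros y. rewrite HL. intuition congruence.
  - exists L'. simpl. split; [|lia]. intros y. rewrite HL. intuition congruence.
Qed.

Lemma SigmaRT1_of_RT m l (p : form) : Sigma (S m) p -> RCA0 ⊢ RT (S m) l ⊃ SigmaRT1_instance l p.
Proof.
  intros Hp. apply completeness; [exact RCA0_subst|]. intros M HM e r HRT.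
  (* The given assignment interprets the set parameters of [p], so it is taken as the fixed one. *)
  pose (HMod := {| model_axioms := HM; assignment := r |}).
  apply (sat_RT (HM := HMod)) in HRT. pose proof (Bnd_pred _ (Bnd_RTsem m l HRT)) as HB.
  intros k HTot. unfold TotalInto in HTot. rewrite sat_and in HTot. destruct HTot as [HT1 HT2].
  assert (HP : SG (S m) (fun e => sat e r (insert 2 1 p))) by now apply (sigma_SG (HM := HMod)), SigmaPi_subst.
  assert (HF : FunOn 1 k (k .: e) (fun e => sat e r (insert 2 1 p))).
  { intros [|x [|]] Hl; try discriminate. simpl eapp.
    specialize (HT1 x). rewrite sat_ExUnique in HT1. destruct HT1 as [y [Hy Hu]].
    specialize (HT2 x). unfold BExUnique in HT2. rewrite sat_ExUnique in HT2.
    destruct HT2 as [y' [Hy' _]]. rewrite sat_and in Hy'. destruct Hy' as [Hlt Hy'].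
    exists y. rewrite (Hu y' Hy') in Hlt. auto. }
  destruct (homogeneous m l _ (k .: e) HRT HB HP HF) as [D [L [HD [HL Hhom]]]].
  destruct (filter_prop (fun y => lt y k) L) as [L' [HL' Hlen]].
  destruct (finite_set_code L') as [s Hs].
  assert (HFM : forall r' (f : nat -> M) a b, f b = s -> sat f r' (Var a ∈f Var b) <-> In (f a) L').
  { intros r' f a b Hb. rewrite sat_FMem, Hb. apply Hs. }
  rewrite sat_exS. exists D. unfold Homogeneous. rewrite sat_and. split.
  { intros x. rewrite sat_ex. destruct (HD x) as [y Hy]. exists y. apply sat_and. exact Hy. }
  rewrite sat_ex. exists s. rewrite !sat_and. split; [|split].
  - intros y Hy. rewrite HFM in Hy by reflexivity. now apply HL' in Hy.
  (* [CardLe] asks for exactly [l] values, repetitions allowed; zeros fill up the list. *)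
  - apply sat_CardLe. exists (L' ++ repeat zero (l - length L')). split.
    + rewrite length_app, repeat_length. lia.
    + intros y Hy. rewrite HFM in Hy by reflexivity. apply in_or_app. now left.
  - intros h Hh. rewrite sat_ex. destruct (Hhom h Hh) as [y [HyL Hy]]. exists y.
    rewrite sat_and. split.
    + rewrite HFM by reflexivity. apply HL'. split; auto.
      destruct (HF [h] eq_refl) as [y' [Hy' [_ Hu]]]. now rewrite (Hu y Hy).
    + apply (sat_insert [y; h] [s] (k .: e)); auto.
      unfold liftS. rewrite sat_subst. exact Hy.
Qed.

Lemma BSigma_of_RT m l (p : form) : Sigma (S (S m)) p -> RCA0 ⊢ RT (S m) l ⊃ B_instance p.
Proof.
  intros Hp. apply completeness; [exact RCA0_subst|]. intros M HM e r HRT.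
  pose (HMod := {| model_axioms := HM; assignment := r |}).
  apply (sat_RT (HM := HMod)) in HRT. pose proof (Bnd_RTsem m l HRT) as HB.
  intros w Hw. rewrite sat_BAll in Hw.
  destruct (HB (fun e => sat e r p)) with (e := e) (w := w) as [v Hv].
  - now apply (sigma_SG (HM := HMod)).
  - intros x Hx. specialize (Hw x Hx). rewrite sat_ex in Hw. destruct Hw as [y Hy].
    exists y. now apply (sat_insert [y; x] [w] e) in Hy.
  - rewrite sat_ex. exists v. apply sat_BAll. intros x Hx.
    destruct (Hv x Hx) as [y [Hy Hpy]]. apply sat_BEx. exists y. split; [exact Hy|].
    now apply (sat_insert [y; x] [v; w] e).
Qed.

Theorem theorem4 :
  (forall n l : nat, 1 <= n -> 1 <= l ->
     proves_scheme RCA0 (RT n l) (SigmaRT1 n l))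
  /\
  (forall n l : nat, 1 <= n -> 1 <= l ->
     proves_scheme RCA0 (RT n l) (BSigma (n + 1))).
Proof.
  split; intros [|m] l Hn _ s [p [Hp ->]]; try (now inversion Hn).
  - now apply SigmaRT1_of_RT.
  - rewrite Nat.add_1_r in Hp. now apply BSigma_of_RT.
Qed.
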